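(* Let $\mathcal{G}$ be a groupoid and let $\Gamma_1$ and $\Gamma_2$ be finitely generated discrete groups. Then there is a groupoid isomorphism from $\left(\mathcal{G} \ltimes \mathcal{S}_{\mathcal{G}}^{\Gamma_1}\right) \ltimes \mathcal{S}_{\mathcal{G} \ltimes \mathcal{S}_{\mathcal{G}}^{\Gamma_1}}^{\Gamma_2}$ to $\mathcal{G} \ltimes \mathcal{S}_{\mathcal{G}}^{\Gamma_1 \times \Gamma_2}$. In particular, if $\mathcal{G}$ is an orbifold groupoid presenting the orbifold $Q$, then the orbifolds $\widetilde{\left(\tilde{Q}_{\Gamma_1}\right)}_{\Gamma_2}$ and $\tilde{Q}_{\Gamma_1 \times \Gamma_2}$, presented by $\left(\mathcal{G} \ltimes \mathcal{S}_{\mathcal{G}}^{\Gamma_1}\right) \ltimes \mathcal{S}_{\mathcal{G} \ltimes \mathcal{S}_{\mathcal{G}}^{\Gamma_1}}^{\Gamma_2}$ and $\mathcal{G} \ltimes \mathcal{S}_{\mathcal{G}}^{\Gamma_1 \times \Gamma_2}$ respectively, are diffeomorphic.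
   Context: A groupoid $\mathcal{G}$ has objects $G_0$, arrows $G_1$, source and target maps $s,t$, and isotropy groups $G_x$ ($x\in G_0$). For a finitely generated discrete group $\Gamma$, $\mathcal{S}_{\mathcal{G}}^{\Gamma} = \mathrm{HOM}(\Gamma,\mathcal{G}) = \bigcup_{x\in G_0}\mathrm{HOM}(\Gamma,G_x)$; elements are written $\phi_x:\Gamma\to G_x$. $\mathcal{G}$ acts on it with anchor map $\phi_x\mapsto x$ by $(h\cdot\phi_x)(\gamma)=h\phi_x(\gamma)h^{-1}$ for $s(h)=x$, and $\mathcal{G}^{\Gamma}=\mathcal{G}\ltimes\mathcal{S}_{\mathcal{G}}^{\Gamma}$ is the translation groupoid of this action (objects $\mathcal{S}_{\mathcal{G}}^{\Gamma}$, arrows pairs $(h,\phi_x)$ with $s(h)=x$, from $\phi_x$ to $h\cdot\phi_x$). An orbifold groupoid is a proper étale Lie groupoid. Every $x\in G_0$ has a neighborhood $V_x\cong\mathbb{R}^n$ ($x$ corresponding to the origin) on which $G_x$ acts linearly with $\mathcal{G}|_{V_x}\cong G_x\ltimes V_x$ (a linear orbifold chart); this isomorphism gives injective homomorphisms $\xi_x^y:G_y\to G_x$ for $y\in V_x$. If $\mathcal{G}$ is an orbifold groupoid, $\mathcal{S}_{\mathcal{G}}^{\Gamma}$ is given the smooth structure with manifold charts near $\phi_x$ the maps $\kappa_{\phi_x}:V_x^{\langle\phi_x\rangle}\to\mathcal{S}_{\mathcal{G}}^{\Gamma}$, $y\mapsto(\xi_x^y)^{-1}\circ\phi_x$, where $V_x^{\langle\phi_x\rangle}$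 is the fixed-point set of $\mathrm{Im}\,\phi_x$. Then $\mathcal{G}^\Gamma$ is again an orbifold groupoid. An orbifold $Q$ is a paracompact Hausdorff space together with a Morita equivalence class of orbifold groupoids $\mathcal{G}$ presenting it (orbit space $|\mathcal{G}|$ identified with the space). Two orbifolds are diffeomorphic if the groupoids presenting them are Morita equivalent. The orbifold of $\Gamma$-sectors $\tilde{Q}_\Gamma$ is the orbifold presented by $\mathcal{G}^{\Gamma}$. *)

(* Defs.v *)
From HB Require Import structures.
From mathcomp Require Import all_boot all_order all_algebra all_fingroup.
From mathcomp Require Import all_classical all_reals all_analysis.

Set Implicit Arguments.
Unset Strict Implicit.
Unset Printing Implicit Defensive.

Import Order.TTheory GRing.Theory Num.Theory.
Import numFieldNormedType.Exports.

Local Open Scope classical_set_scope.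
Local Open Scope ring_scope.

(* Arrows compose as functions do: [comp g h] is "g after h" and takes a      *)
(* proof that the source of g is the target of h.                             *)

Record groupoid := Groupoid {
  ob : Type;
  arr : Type;
  src : arr -> ob;
  tgt : arr -> ob;
  idn : ob -> arr;
  inv : arr -> arr;
  comp : forall g h : arr, src g = tgt h -> arr;
  src_idn : forall x, src (idn x) = x;
  tgt_idn : forall x, tgt (idn x) = x;
  src_inv : forall g, src (inv g) = tgt g;
  tgt_inv : forall g, tgt (inv g) = src g;
  src_comp : forall g h (e : src g = tgt h), src (comp e) = src h;
  tgt_comp : forall g h (e : src g = tgt h), tgt (comp e) = tgt g;
  compA : forall g h k (e1 : src g = tgt h) (e2 : src h = tgt k)
    (e3 : src g = tgt (comp e2)) (e4 : src (comp e1) = tgt k),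
    comp e3 = comp e4;
  comp_idl : forall g (e : src (idn (tgt g)) = tgt g), comp e = g;
  comp_idr : forall g (e : src g = tgt (idn (src g))), comp e = g;
  comp_invl : forall g (e : src (inv g) = tgt g), comp e = idn (src g);
  comp_invr : forall g (e : src g = tgt (inv g)), comp e = idn (tgt g)
}.

Arguments idn {_}.
Arguments comp {_} _ _ _.
Arguments compA {_ _ _ _} e1 e2 e3 e4.

Record gfunctor (G H : groupoid) := GFunctor {
  fob : ob G -> ob H;
  farr : arr G -> arr H;
  fsrc : forall g, src (farr g) = fob (src g);
  ftgt : forall g, tgt (farr g) = fob (tgt g);
  fidn : forall x, farr (idn x) = idn (fob x);
  fcomp : forall g h (e : src g = tgt h) (e' : src (farr g) = tgt (farr h)),
    farr (comp g h e) = comp (farr g) (farr h) e'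
}.

Definition groupoid_isomorphic (G H : groupoid) :=
  exists F : gfunctor G H, bijective (fob F) /\ bijective (farr F).

Section GroupoidLemmas.
Variable G : groupoid.
Implicit Types (x : ob G) (g h k : arr G).

Lemma comp_congr g g' h h' (e : src g = tgt h) (e' : src g' = tgt h') :
  g = g' -> h = h' -> comp g h e = comp g' h' e'.
Proof. by move=> gg hh; subst g' h'; congr comp; exact: Prop_irrelevance. Qed.

Lemma comp_idl_at x g (e : src (idn x) = tgt g) : comp (idn x) g e = g.
Proof.
have xE : x = tgt g by rewrite -e src_idn.
by subst x; exact: comp_idl.
Qed.

Lemma comp_idr_at x g (e : src g = tgt (idn x)) : comp g (idn x) e = g.
Proof.
have xE : x = src g by rewrite e tgt_idn.
by subst x; exact: comp_idr.
Qed.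

Lemma inv_unique g h (e : src h = tgt g) :
  comp h g e = idn (src g) -> h = inv g.
Proof.
move=> hg.
have e1 : src g = tgt (inv g) by rewrite tgt_inv.
have e2 : src h = tgt (comp g (inv g) e1) by rewrite tgt_comp.
have e3 : src (comp h g e) = tgt (inv g) by rewrite src_comp.
have e4 : src h = tgt (idn (tgt g)) by rewrite tgt_idn.
have e5 : src (idn (src g)) = tgt (inv g) by rewrite src_idn.
rewrite -[LHS](comp_idr_at e4) -[RHS](comp_idl_at e5).
rewrite -(comp_congr e3 e5 hg erefl) -(compA e e1 e2 e3).
by apply: comp_congr => //; rewrite comp_invr.
Qed.

End GroupoidLemmas.

Record action (G : groupoid) := Action {
  aset : Type;
  anchor : aset -> ob G;
  act : forall (h : arr G) (x : aset), src h = anchor x -> aset;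
  anchor_act : forall h x (e : src h = anchor x), anchor (act e) = tgt h;
  act_idn : forall x (e : src (idn (anchor x)) = anchor x), act e = x;
  act_comp : forall g h x (e : src g = tgt h) (e1 : src (comp g h e) = anchor x)
    (e2 : src h = anchor x) (e3 : src g = anchor (act e2)), act e1 = act e3
}.

Arguments act {_ _} _ _ _.
Arguments act_comp {_ _ _ _ _} e e1 e2 e3.

Section Translation.
Variables (G : groupoid) (A : action G).

Definition tr_arr := {p : arr G * aset A | src p.1 = anchor p.2}.

Definition tr_src (p : tr_arr) : aset A := (sval p).2.

Definition tr_tgt (p : tr_arr) : aset A := act (sval p).1 (sval p).2 (proj2_sig p).

Definition tr_idn (x : aset A) : tr_arr :=
  exist _ (idn (anchor x), x) (src_idn (anchor x)).

Lemma tr_inv_proof (p : tr_arr) : src (inv (sval p).1) = anchor (tr_tgt p).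
Proof. by rewrite src_inv anchor_act. Qed.

Definition tr_inv (p : tr_arr) : tr_arr :=
  exist _ (inv (sval p).1, tr_tgt p) (tr_inv_proof p).

Lemma tr_comp_proof1 (p q : tr_arr) :
  tr_src p = tr_tgt q -> src (sval p).1 = tgt (sval q).1.
Proof. by move=> e; rewrite (proj2_sig p) [(sval p).2]e anchor_act. Qed.

Lemma tr_comp_proof2 (p q : tr_arr) (e : tr_src p = tr_tgt q) :
  src (comp _ _ (tr_comp_proof1 e)) = anchor (sval q).2.
Proof. by rewrite src_comp (proj2_sig q). Qed.

Definition tr_comp (p q : tr_arr) (e : tr_src p = tr_tgt q) : tr_arr :=
  exist _ (comp _ _ (tr_comp_proof1 e), (sval q).2) (tr_comp_proof2 e).

Lemma tr_arr_eq (p q : tr_arr) :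
  (sval p).1 = (sval q).1 -> (sval p).2 = (sval q).2 -> p = q.
Proof.
case: p => -[g x] /= gx; case: q => -[h y] /= hy gh xy.
by subst h y; congr exist; exact: Prop_irrelevance.
Qed.

Lemma act_congr g g' (x x' : aset A) (e : src g = anchor x)
    (e' : src g' = anchor x') :
  g = g' -> x = x' -> act g x e = act g' x' e'.
Proof. by move=> gg xx; subst g' x'; congr act; exact: Prop_irrelevance. Qed.

Lemma tr_tgt_idn x : tr_tgt (tr_idn x) = x.
Proof. exact: act_idn. Qed.

Lemma tr_tgt_comp (p q : tr_arr) (e : tr_src p = tr_tgt q) :
  tr_tgt (tr_comp e) = tr_tgt p.
Proof.
have e3 : src (sval p).1 = anchor (tr_tgt q) by rewrite -e (proj2_sig p).
transitivity (act _ _ e3); last exact: act_congr.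
exact: (act_comp (tr_comp_proof1 e) (tr_comp_proof2 e) (proj2_sig q) e3).
Qed.

Lemma tr_tgt_inv (p : tr_arr) : tr_tgt (tr_inv p) = tr_src p.
Proof.
have e : src (inv (sval p).1) = tgt (sval p).1 by rewrite src_inv.
have e1 : src (comp _ _ e) = anchor (sval p).2 by rewrite src_comp (proj2_sig p).
transitivity (act _ _ e1).
  exact: (esym (act_comp e e1 (proj2_sig p) (tr_inv_proof p))).
rewrite /tr_src.
rewrite -[RHS](act_idn (src_idn (anchor (sval p).2))).
by apply: act_congr => //; rewrite comp_invl (proj2_sig p).
Qed.

Definition translation_groupoid : groupoid.
Proof.
refine (@Groupoid (aset A) tr_arr tr_src tr_tgt tr_idn tr_inv tr_comp
  _ tr_tgt_idn _ tr_tgt_inv _ tr_tgt_comp _ _ _ _ _) => //.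
- by move=> p q r e1 e2 e3 e4; apply: tr_arr_eq => //=; exact: compA.
- by move=> p e; apply: tr_arr_eq => //=; exact: comp_idl_at.
- move=> p e; apply: tr_arr_eq => /=; last by [].
  exact: comp_idr_at.
- move=> p e; apply: tr_arr_eq => //=; rewrite comp_invl.
  by rewrite (proj2_sig p).
- by move=> p e; apply: tr_arr_eq => //=; rewrite comp_invr anchor_act.
Defined.

End Translation.

Definition finitely_generated (Gam : groupType) :=
  exists s : seq Gam, forall P : Gam -> Prop,
    P 1%g -> (forall a b, P a -> P b -> P (a * b)%g) ->
    (forall a, P a -> P a^-1%g) -> (forall a, a \in s -> P a) ->
    forall a, P a.

Definition isotropy (G : groupoid) (x : ob G) (g : arr G) :=
  src g = x /\ tgt g = x.

Section Hom.
Variables (Gam : groupType) (G : groupoid).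

(* A homomorphism from Gam to the isotropy group of G at [base]. *)
Record ghom := GHom {
  base : ob G;
  hfun : Gam -> arr G;
  hiso : forall a, isotropy base (hfun a);
  hmul : forall a b (e : src (hfun a) = tgt (hfun b)),
    hfun (a * b)%g = comp (hfun a) (hfun b) e
}.

Lemma ghom_eq (f f' : ghom) : base f = base f' -> hfun f =1 hfun f' -> f = f'.
Proof.
case: f => x f i m; case: f' => x' f' i' m' /= xx /funext ff; subst x' f'.
by congr GHom; exact: Prop_irrelevance.
Qed.

Lemma conj_proof1 (h : arr G) (f : ghom) (e : src h = base f) a :
  src h = tgt (hfun f a).
Proof. by rewrite e (hiso f a).2. Qed.

Lemma conj_proof2 (h : arr G) (f : ghom) (e : src h = base f) a :
  src (comp _ _ (conj_proof1 e a)) = tgt (inv h).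
Proof. by rewrite src_comp tgt_inv (hiso f a).1. Qed.

Definition conj_fun (h : arr G) (f : ghom) (e : src h = base f) (a : Gam) :=
  comp (comp h (hfun f a) (conj_proof1 e a)) (inv h) (conj_proof2 e a).

Lemma conj_iso (h : arr G) (f : ghom) (e : src h = base f) a :
  isotropy (tgt h) (conj_fun e a).
Proof. by split; rewrite ?src_comp ?src_inv // !tgt_comp. Qed.

Lemma conj_mul (h : arr G) (f : ghom) (e : src h = base f) a b
    (e' : src (conj_fun e a) = tgt (conj_fun e b)) :
  conj_fun e (a * b)%g = comp (conj_fun e a) (conj_fun e b) e'.
Proof.
have ei : src (inv h) = tgt (conj_fun e b) by rewrite src_inv (conj_iso e b).2.
have ha : src (hfun f a) = src h by rewrite (hiso f a).1.
have hb : src (hfun f b) = src h by rewrite (hiso f b).1.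
have ab : src (hfun f a) = tgt (hfun f b) by rewrite (hiso f b).2 (hiso f a).1.
set ha' := comp h (hfun f a) (conj_proof1 e a).
have e2 : src ha' = tgt (comp (inv h) (conj_fun e b) ei).
  by rewrite tgt_comp tgt_inv src_comp.
rewrite -(compA (conj_proof2 e a) ei e2 e').
have ek1 : src (hfun f b) = tgt (inv h) by rewrite tgt_inv.
have ek : src ha' = tgt (comp (hfun f b) (inv h) ek1).
  by rewrite tgt_comp src_comp.
have -> : comp ha' _ e2 = comp ha' _ ek.
  apply: comp_congr => //.
  have hf : src h = tgt (comp (hfun f b) (inv h) ek1).
    by rewrite tgt_comp (hiso f b).2.
  have ei' : src (inv h) = tgt (comp h _ hf) by rewrite src_inv tgt_comp.
  rewrite -[LHS]/(comp _ _ ei) (comp_congr ei ei' erefl); last first.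
    by rewrite /conj_fun; exact/esym/compA.
  have eih : src (inv h) = tgt h by rewrite src_inv.
  have e6 : src (comp (inv h) h eih) = tgt (comp (hfun f b) (inv h) ek1).
    by rewrite src_comp.
  rewrite (compA eih hf ei' e6).
  have e7 : src (idn (src h)) = tgt (comp (hfun f b) (inv h) ek1).
    by rewrite src_idn.
  rewrite (comp_congr e6 e7 (comp_invl _) erefl).
  exact: comp_idl_at.
have eab : src ha' = tgt (hfun f b) by rewrite src_comp.
have e8 : src (comp ha' (hfun f b) eab) = tgt (inv h) by rewrite src_comp.
rewrite (compA eab ek1 ek e8) /conj_fun; apply: comp_congr => //.
have e9 : src h = tgt (comp _ _ ab) by rewrite tgt_comp (hiso f a).2.
rewrite -(compA (conj_proof1 e a) ab e9 eab).
by apply: comp_congr => //; exact: hmul.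
Qed.

Definition conj_hom (h : arr G) (f : ghom) (e : src h = base f) : ghom :=
  GHom (conj_iso e) (@conj_mul h f e).

Definition hom_action : action G.
Proof.
refine (@Action G ghom base conj_hom _ _ _) => //.
- move=> f e; apply: ghom_eq => [|a] /=; first by rewrite tgt_idn.
  rewrite /conj_fun.
  have e0 : src (hfun f a) = tgt (inv (idn (base f))).
    by rewrite tgt_inv src_idn (hiso f a).1.
  rewrite (comp_congr _ e0 (comp_idl_at _) erefl).
  have ii : inv (idn (base f)) = idn (base f).
    have ee : src (idn (base f)) = tgt (idn (base f)) by rewrite src_idn tgt_idn.
    by apply/esym/(inv_unique (e := ee)); rewrite comp_idl_at src_idn.
  have e1 : src (hfun f a) = tgt (idn (base f)).
    by rewrite tgt_idn (hiso f a).1.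
  by rewrite (comp_congr e0 e1 erefl ii) comp_idr_at.
- move=> g h f e e1 e2 e3; apply: ghom_eq => [|a] /=; first by rewrite tgt_comp.
  have ehg : src (inv h) = tgt (inv g) by rewrite src_inv tgt_inv.
  have iE : inv (comp g h e) = comp (inv h) (inv g) ehg.
    have e4 : src (comp (inv h) (inv g) ehg) = tgt (comp g h e).
      by rewrite src_comp src_inv tgt_comp.
    apply/esym/(inv_unique (e := e4)); rewrite src_comp.
    have e5 : src (inv g) = tgt (comp g h e) by rewrite src_inv tgt_comp.
    have e6 : src (inv h) = tgt (comp (inv g) _ e5).
      by rewrite tgt_comp tgt_inv src_inv.
    rewrite -(compA ehg e5 e6 e4).
    have e7 : src (inv h) = tgt h by rewrite src_inv.
    rewrite -[RHS](comp_invl e7); apply: comp_congr => //.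
    have e8 : src (inv g) = tgt g by rewrite src_inv.
    have e9 : src (comp (inv g) g e8) = tgt h by rewrite src_comp.
    rewrite (compA e8 e e5 e9).
    have e10 : src (idn (src g)) = tgt h by rewrite src_idn.
    by rewrite (comp_congr e9 e10 (comp_invl _) erefl) comp_idl_at.
  rewrite /conj_fun.
  set f1 := comp h (hfun f a) (conj_proof1 e2 a).
  have q1 : src g = tgt f1 by rewrite tgt_comp.
  have q2 : src f1 = tgt (comp (inv h) (inv g) ehg).
    by rewrite tgt_comp tgt_inv src_comp (hiso f a).1.
  have q3 : src (comp g f1 q1) = tgt (comp (inv h) (inv g) ehg).
    by rewrite src_comp.
  transitivity (comp (comp g f1 q1) _ q3).
    by apply: comp_congr => //; exact/esym/compA.
  have q4 : src (comp g f1 q1) = tgt (inv h).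
    by rewrite src_comp (conj_proof2 e2 a).
  have q5 : src (comp _ _ q4) = tgt (inv g) by rewrite src_comp.
  rewrite (compA q4 ehg q3 q5); apply: comp_congr => //=.
  exact/esym/compA.
Defined.

Definition sector_groupoid : groupoid := translation_groupoid hom_action.

End Hom.

(* The dimension of a parametrization is not fixed, since the components of   *)
(* HOM(Gam, G) have different dimensions.                                     *)

Definition paracompact (T : topologicalType) :=
  forall C : set (set T), (forall U, C U -> open U) ->
    (forall x, exists2 U, C U & U x) ->
  exists D : set (set T), [/\ forall V, D V -> open V,
    forall x, exists2 V, D V & V x,
    forall V, D V -> exists2 U, C U & V `<=` U &
    forall x : T, exists2 N : set T, nbhs x N &
      finite_set [set V | D V /\ V `&` N !=set0]].

Section Smooth.
Variable R : realType.

Fixpoint Cn (m : nat) (k n : nat) (U : set 'rV[R]_k) (f : 'rV[R]_k -> 'rV[R]_n)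
    : Prop :=
  if m is m'.+1 then
    (forall u, U u -> differentiable f u) /\
    (forall v, Cn m' U (fun u => 'd f u v))
  else forall u, U u -> {for u, continuous f}.

(* To be used for U open. *)
Definition smooth_on k n (U : set 'rV[R]_k) (f : 'rV[R]_k -> 'rV[R]_n) :=
  forall m, Cn m U f.

Record param (T : Type) := Param {
  pdim : nat;
  pdom : set 'rV[R]_pdim;
  pmap : 'rV[R]_pdim -> T
}.

Arguments pdom {T} p.
Arguments pmap {T} p.

(* A set with a set of local parametrizations; it is a manifold only when     *)
(* [is_manifold] holds.                                                       *)
Record mfd := Mfd { carrier : Type; atlas : set (param carrier) }.
Arguments atlas m _ : clear implicits.

Definition rep_dom S T (f : S -> T) (p : param S) (q : param T) :=
  [set u | pdom p u /\ exists2 v, pdom q v & pmap q v = f (pmap p u)].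
Arguments rep_dom {S T} f p q _.

(* g is q^-1 o f o p *)
Definition is_rep S T (f : S -> T) (p : param S) (q : param T)
    (g : 'rV[R]_(pdim p) -> 'rV[R]_(pdim q)) :=
  smooth_on (rep_dom f p q) g /\
  forall u, rep_dom f p q u -> pdom q (g u) /\ pmap q (g u) = f (pmap p u).
Arguments is_rep {S T} f p q g.

Definition smooth_rep S T (f : S -> T) (p : param S) (q : param T) :=
  open (rep_dom f p q) /\ exists g, is_rep f p q g.
Arguments smooth_rep {S T} f p q.

Definition smooth (M N : mfd) (f : carrier M -> carrier N) :=
  forall p q, atlas M p -> atlas N q -> smooth_rep f p q.
Arguments smooth {M N} f.

(* Smooth maps from an open subset of some R^k to M *)
Definition plot (M : mfd) (p : param (carrier M)) :=
  open (pdom p) /\ forall q, atlas M q -> smooth_rep id p q.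
Arguments plot {M} p.

(* p belongs to the maximal atlas *)
Definition chart (M : mfd) (p : param (carrier M)) :=
  [/\ open (pdom p),
    forall u v, pdom p u -> pdom p v -> pmap p u = pmap p v -> u = v &
    forall q, atlas M q -> smooth_rep id p q /\ smooth_rep id q p].
Arguments chart {M} p.

(* M with the topology in which the parametrizations in the atlas are open    *)
(* embeddings                                                                 *)
Definition mspace (M : mfd) : Type := carrier M.

Section MspaceTopology.
Variable M : mfd.

HB.instance Definition _ := gen_eqMixin (mspace M).
HB.instance Definition _ := gen_choiceMixin (mspace M).

Definition mopen : set_system (mspace M) :=
  [set A | forall p, atlas M p -> open [set u | pdom p u /\ A (pmap p u)]].

(* The whole space is added as an alternative only so that this is a topology *)
(* for any atlas; it is redundant when the domains of the atlas are open.     *)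
Definition mtop : set_system (mspace M) := [set A | A = setT \/ mopen A].

Lemma mtopT : mtop setT. Proof. by left. Qed.

Lemma mtopI : setI_closed mtop.
Proof.
move=> A B [->|oA] [->|oB]; rewrite ?setTI ?setIT; [by left|by right..|right].
move=> p Mp; have := openI (oA p Mp) (oB p Mp).
by congr open; apply/seteqP; split=> u /= => [[[? ?] [? ?]]|[? [? ?]]].
Qed.

Lemma mtopU (I : Type) (F : I -> set (mspace M)) :
  (forall i, mtop (F i)) -> mtop (\bigcup_i F i).
Proof.
move=> oF; have [[i iT]|nT] := pselect (exists i, F i = setT).
  by left; apply/seteqP; split=> // x _; exists i => //; rewrite iT.
right=> p Mp; rewrite (_ : [set u | _] =
    \bigcup_i [set u | pdom p u /\ F i (pmap p u)]).
  apply: bigcup_open => i _; case: (oF i) => [iT|]; last exact.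
  by case: nT; exists i.
by apply/seteqP; split=> u /= => [[pu [i _ Fi]]|[i _ [pu Fi]]];
  [exists i|split=> //; exists i].
Qed.

HB.instance Definition _ := isOpenTopological.Build (mspace M) mtopT mtopI mtopU.

End MspaceTopology.

Definition is_manifold (M : mfd) :=
  [/\ forall p, atlas M p -> chart p,
    forall x : carrier M, exists2 p, atlas M p & exists2 u, pdom p u & pmap p u = x,
    hausdorff_space (mspace M) &
    paracompact (mspace M)].

(* The atlas of all injective parametrizations p among the plots P such that  *)
(* every plot in P is locally a smooth reparametrization of p. For P the maps *)
(* into a product of manifolds, or into an embedded submanifold of it, that   *)
(* are componentwise smooth, these are the charts of the product or of the    *)
(* submanifold.                                                               *)
Definition plot_atlas T (P : set (param T)) : set (param T) :=
  [set p | [/\ P p,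
    forall u v, pdom p u -> pdom p v -> pmap p u = pmap p v -> u = v &
    forall q, P q -> smooth_rep id q p]].

Definition comp_param S T (f : S -> T) (p : param S) : param T :=
  Param (pdom p) (f \o pmap p).

Definition fibprod (X Y : mfd) (Z : Type) (f : carrier X -> Z)
    (g : carrier Y -> Z) : mfd :=
  let T := {p : carrier X * carrier Y | f p.1 = g p.2} in
  Mfd (plot_atlas [set p : param T |
    plot (comp_param (fun t : T => (sval t).1) p) /\
    plot (comp_param (fun t : T => (sval t).2) p)]).

Definition local_diffeo (M N : mfd) (f : carrier M -> carrier N) :=
  smooth f /\
  forall x, exists p : param (carrier M),
    [/\ chart p, exists2 u, pdom p u & pmap p u = x & chart (comp_param f p)].

Definition submersion (M N : mfd) (f : carrier M -> carrier N) :=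
  smooth f /\
  forall p q, atlas M p -> atlas N q ->
  forall g, is_rep f p q g -> forall u, rep_dom f p q u ->
  forall w, exists v, 'd g u v = w.

Definition proper_map (S T : topologicalType) (f : S -> T) :=
  forall K : set T, compact K -> compact (f @^-1` K).

Record gpd_with_atlases := GpdWithAtlases {
  gpd :> groupoid;
  ob_atlas : set (param (ob gpd));
  arr_atlas : set (param (arr gpd))
}.

Definition obm (G : gpd_with_atlases) : mfd := Mfd (@ob_atlas G).
Definition arrm (G : gpd_with_atlases) : mfd := Mfd (@arr_atlas G).

Definition fib_comp (G : gpd_with_atlases)
    (p : carrier (@fibprod (arrm G) (arrm G) _ (@src G) (@tgt G))) : arr G :=
  comp (sval p).1 (sval p).2 (proj2_sig p).

Definition lie_groupoid (G : gpd_with_atlases) :=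
  [/\ is_manifold (obm G) /\ is_manifold (arrm G),
    @submersion (arrm G) (obm G) (@src G) /\
    @submersion (arrm G) (obm G) (@tgt G),
    @smooth (obm G) (arrm G) (@idn G),
    @smooth (arrm G) (arrm G) (@inv G) &
    @smooth (@fibprod (arrm G) (arrm G) _ (@src G) (@tgt G)) (arrm G)
      (@fib_comp G)].

Definition etale (G : gpd_with_atlases) :=
  @local_diffeo (arrm G) (obm G) (@src G) /\
  @local_diffeo (arrm G) (obm G) (@tgt G).

Definition st_map (G : gpd_with_atlases) (g : mspace (arrm G)) :
  (mspace (obm G) * mspace (obm G))%type := (@src G g, @tgt G g).

Definition orbifold_groupoid (G : gpd_with_atlases) :=
  [/\ lie_groupoid G, etale G & proper_map (@st_map G)].

(* In the second item: the square formed by F on arrows, F on objects, and    *)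
(* (source, target) is a fibred product of manifolds, i.e. it is one of sets  *)
(* and a map from an open subset of R^k to the arrows of H is smooth as soon  *)
(* as its components are.                                                     *)
Definition lie_equivalence (H G : gpd_with_atlases) (F : gfunctor H G) :=
  [/\ @smooth (obm H) (obm G) (fob F) /\ @smooth (arrm H) (arrm G) (farr F),
    let P := @fibprod (arrm G) (obm H) _ (@src G) (fob F) in
    let f := fun p : carrier P => @tgt G (sval p).1 in
    @submersion P (obm G) f /\ (forall x, exists p, f p = x),
    forall (y y' : ob H) (g : arr G), src g = fob F y -> tgt g = fob F y' ->
      exists! h : arr H, [/\ src h = y, tgt h = y' & farr F h = g] &
    forall p : param (arr H), open (pdom p) ->
      @plot (obm H) (comp_param (@src H) p) ->
      @plot (obm H) (comp_param (@tgt H) p) ->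
      @plot (arrm G) (comp_param (farr F) p) ->
      @plot (arrm H) p].

Definition morita_equivalent (G G' : gpd_with_atlases) :=
  exists H : gpd_with_atlases, lie_groupoid H /\
    (exists F : gfunctor H G, lie_equivalence F) /\
    (exists F : gfunctor H G', lie_equivalence F).

(* pi identifies X with the orbit space |G|. *)
Definition orbit_space_map (G : gpd_with_atlases) (X : topologicalType)
    (pi : mspace (obm G) -> X) :=
  [/\ forall y, exists x, pi x = y,
    forall x x', pi x = pi x' <-> exists g : arr G, src g = x /\ tgt g = x' &
    forall A : set X, open A <-> open (pi @^-1` A)].

Record orbifold := Orbifold {
  ospace : topologicalType;
  presents : gpd_with_atlases -> Prop;
  ospace_hausdorff : hausdorff_space ospace;
  ospace_paracompact : paracompact ospace;
  presents_ex : exists G, presents G;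
  presents_morita : forall G, presents G -> forall H,
    presents H <-> orbifold_groupoid H /\ morita_equivalent G H;
  presents_orbits : forall G, presents G ->
    exists pi : mspace (obm G) -> ospace, orbit_space_map pi
}.

Definition orbifold_diffeomorphic (Q Q' : orbifold) :=
  exists G G', [/\ presents Q G, presents Q' G' & morita_equivalent G G'].

(* [lc_map] parametrizes V_x by R^n, [lc_act] is the linear action of the     *)
(* isotropy group G_x, and [lc_arr g u] is the arrow of G restricted to V_x   *)
(* corresponding to (g, u) in the translation groupoid of G_x acting on R^n.  *)
(* The values of [lc_act] and [lc_arr] at arrows outside G_x are irrelevant.  *)
Record linear_chart (G : gpd_with_atlases) (x : ob G) := LinearChart {
  lc_dim : nat;
  lc_map : 'rV[R]_lc_dim -> ob G;
  lc_act : arr G -> 'rV[R]_lc_dim -> 'rV[R]_lc_dim;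
  lc_arr : arr G -> 'rV[R]_lc_dim -> arr G;
  lc_chart : @chart (obm G) (Param setT lc_map);
  lc_map0 : lc_map 0 = x;
  lc_act_linear : forall g, isotropy x g -> linear (lc_act g);
  lc_act_idn : forall u, lc_act (idn x) u = u;
  lc_act_comp : forall g h (e : src g = tgt h) u,
    isotropy x g -> isotropy x h ->
    lc_act (comp g h e) u = lc_act g (lc_act h u);
  lc_arr_chart : forall g, isotropy x g ->
    @chart (arrm G) (Param setT (lc_arr g));
  lc_src : forall g u, isotropy x g -> src (lc_arr g u) = lc_map u;
  lc_tgt : forall g u, isotropy x g -> tgt (lc_arr g u) = lc_map (lc_act g u);
  lc_arr_comp : forall g h (e : src g = tgt h) u
    (e' : src (lc_arr g (lc_act h u)) = tgt (lc_arr h u)),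
    isotropy x g -> isotropy x h ->
    lc_arr (comp g h e) u = comp (lc_arr g (lc_act h u)) (lc_arr h u) e';
  lc_arr0 : forall g, isotropy x g -> lc_arr g 0 = g;
  lc_arr_inj : forall g h u, isotropy x g -> isotropy x h ->
    lc_arr g u = lc_arr h u -> g = h;
  lc_arr_surj : forall (a : arr G) u v, src a = lc_map u -> tgt a = lc_map v ->
    exists2 g, isotropy x g & lc_arr g u = a
}.

Arguments lc_map {G x} l.
Arguments lc_act {G x} l.
Arguments lc_arr {G x} l.

(* For y = lc_map u, the homomorphism xi_x^y from G_y to G_x sends            *)
(* [lc_arr g u] to g, so (xi_x^y)^-1 o phi is a |-> lc_arr (phi a) u. The     *)
(* fixed-point set of the image of phi is a linear subspace of R^n and is     *)
(* identified with some R^k by a linear isomorphism w |-> w *m B, so as to    *)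
(* obtain a parametrization by R^k.                                           *)
Definition kappa_atlas (Gam : groupType) (G : gpd_with_atlases) :
    set (param (ghom Gam G)) :=
  [set p | exists (phi : ghom Gam G) (L : linear_chart (base phi))
      (B : 'M[R]_(pdim p, lc_dim L)),
    [/\ row_free B,
      forall u : 'rV[R]_(lc_dim L),
        (u <= B)%MS <-> forall a, lc_act L (hfun phi a) u = u,
      pdom p = setT,
      forall w, base (pmap p w) = lc_map L (w *m B) &
      forall w a, hfun (pmap p w) a = lc_arr L (hfun phi a) (w *m B)]].

Definition sector_lie_groupoid (Gam : groupType) (G : gpd_with_atlases) :
    gpd_with_atlases :=
  @GpdWithAtlases (sector_groupoid Gam G) (@kappa_atlas Gam G)
    (atlas (@fibprod (arrm G) (Mfd (@kappa_atlas Gam G)) _ (@src G)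
      (@base Gam G))).

End Smooth.

(* Main.v *)
(** A homomorphism from Gam2 to an isotropy group of G^Gam1 at phi assigns to
each b an arrow of G commuting with all phi a, hence amounts to a homomorphism
(a, b) |-> phi a * h_b from Gam1 * Gam2. For the orbifold part, in the linear
chart around phi the arrows close to the image of phi form sheets indexed by
the isotropy group, so a family of homomorphisms is smooth for the kappa charts
as soon as its base point and its values on finitely many generators are. The
smooth structure of HOM(Gam, G) is thus the pointwise one, and the bijections
above preserve smooth families in both directions. Every groupoid presenting
an orbifold is Morita equivalent to itself; composing one leg of such a span
over the iterated sector groupoid with the isomorphism gives the equivalence. *)

From HB Require Import structures.
From mathcomp Require Import all_boot all_order all_algebra all_fingroup.
From mathcomp Require Import all_classical all_reals all_analysis.
Require Import Defs.

Set Implicit Arguments.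
Unset Strict Implicit.
Unset Printing Implicit Defensive.

Import Order.TTheory GRing.Theory Num.Theory.
Import numFieldNormedType.Exports.

Local Open Scope classical_set_scope.
Local Open Scope ring_scope.

(** * Smooth maps between open subsets of row spaces *)

Section Differentials.
Variables (R : realType) (V W : normedModType R).

(** Only the germ at x matters: g inherits the first-order expansion of f up to a little-o, and such
    an expansion determines the differential. *)
Lemma near_eq_differentiable (f g : V -> W) x :
  (\near x, f x = g x) -> differentiable f x ->
  differentiable g x /\ 'd g x = 'd f x :> (V -> W).
Proof.
move=> fg df; have fgx : f x = g x by exact: nbhs_singleton fg.
have gE : g \o shift x = cst (g x) + 'd f x +o_ 0 id.
  apply/eqaddoP => e e0.
  have := diff_locally df; move/eqaddoP => /(_ e e0).
  have : \forall y \near (0 : V), f (y + x) = g (y + x).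
    by rewrite (near_shift x) /= sub0r; near do rewrite /= addrNK.
  apply: filterS2 => y /= fgy.
  by rewrite !fctE /= fgx fgy.
have dE : 'd g x = 'd f x :> (V -> W).
  by apply: diff_unique => //; exact: diff_continuous.
by split=> //; apply/diff_locallyP; rewrite dE; split=> //; exact: diff_continuous.
Unshelve. all: by end_near. Qed.

(** With the scalars regarded as the normed module [R^o], scaling is a bilinear map of normed
    modules, so the product rule follows from the differential of a continuous bilinear map. *)
Lemma scale_is_bilinear :
  bilinear_for
    (GRing.Scale.Law.clone _ _ *:%R _) (GRing.Scale.Law.clone _ _ *:%R _)
    ( *:%R : R^o -> V -> V).
Proof.
split=> [u'|u] a x y /=.
- by rewrite scalerDl scalerA.
- by rewrite scalerDr !scalerA mulrC.
Qed.

HB.instance Definition _ := bilinear_isBilinear.Build R R^o V V _ _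
  ( *:%R : R^o -> V -> V) scale_is_bilinear.

Lemma is_diff_scale (p : R^o * V) :
  is_diff p (fun q : R^o * V => q.1 *: q.2 : V)
    (fun q => p.1 *: q.2 + q.1 *: p.2).
Proof.
have c : continuous (fun q : R^o * V => q.1 *: q.2 : V).
  by move=> q; apply: (@scale_continuous R V).
by apply: DiffDef; [exact: differentiable_bilin|exact: diff_bilin].
Qed.

End Differentials.

Section Cn_theory.
Variable R : realType.
Implicit Types m k n : nat.

Lemma CnS m k n (U : set 'rV[R]_k) (f : 'rV[R]_k -> 'rV[R]_n) :
  Cn m.+1 U f -> Cn m U f.
Proof.
elim: m f => [|m IH] f [df dvf].
  by move=> u Uu; exact/differentiable_continuous/df.
by split=> // v; apply: IH.
Qed.

(** [Cn] imposes conditions point by point on a function defined on the whole space, so W can be any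
    set through u, open or not. *)
Lemma Cn_cover m k n (U : set 'rV[R]_k) (g : 'rV[R]_k -> 'rV[R]_n) :
  (forall u, U u -> exists2 W : set 'rV[R]_k, W u & Cn m W g) -> Cn m U g.
Proof.
elim: m g => [|m IH] g cov.
  by move=> u /cov[W Wu Wg]; exact: Wg.
split=> [u /cov[W Wu [dg _]]|v]; first exact: dg.
by apply: IH => u /cov[W Wu [_ dg]]; exists W; last exact: dg.
Qed.

Lemma Cn_subset m k n (U W : set 'rV[R]_k) (g : 'rV[R]_k -> 'rV[R]_n) :
  U `<=` W -> Cn m W g -> Cn m U g.
Proof. by move=> UW Wg; apply: Cn_cover => u /UW Wu; exists W. Qed.

(** Openness of U makes f and g agree near each of its points, so their directional derivatives
    agree on U as well and the induction continues. *)
Lemma eq_Cn m k n (U : set 'rV[R]_k) (f g : 'rV[R]_k -> 'rV[R]_n) :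
  open U -> (forall u, U u -> f u = g u) -> Cn m U f -> Cn m U g.
Proof.
move=> oU; elim: m f g => [|m IH] f g fg.
  move=> cf u Uu; suff: g @ nbhs u --> g u by []; rewrite -fg //.
  apply: cvg_trans (cf u Uu); apply: near_eq_cvg.
  by apply: filterS (open_nbhs_nbhs (conj oU Uu)) => y /fg.
move=> [df dvf].
have ng u : U u -> differentiable g u /\ 'd g u = 'd f u :> (_ -> _).
  move=> Uu; apply: near_eq_differentiable; last exact: df.
  by apply: filterS (open_nbhs_nbhs (conj oU Uu)) => y /fg.
split=> [u /ng[]//|v]; apply: IH (dvf v) => u /ng[_ dE].
exact: (esym (f_equal (@^~ v) dE)).
Qed.

Lemma Cn_cst m k n (U : set 'rV[R]_k) (c : 'rV[R]_n) :
  Cn m U (fun _ : 'rV[R]_k => c).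
Proof.
elim: m c => [|m IH] c; first by move=> u _; apply: cst_continuous.
split=> [u _|v]; first exact: differentiable_cst.
suff -> : (fun u : 'rV[R]_k => 'd (fun _ => c) u v) = (fun _ => 0) by exact: IH.
by apply/funext => u; exact: (f_equal (@^~ v) (diff_cst c u)).
Qed.

Lemma Cn_id m k (U : set 'rV[R]_k) : Cn m U (fun u : 'rV[R]_k => u).
Proof.
case: m => [|m]; first by move=> u _ A.
have did (u : 'rV[R]_k) := is_diff_id u.
split=> [u _|v]; first exact: (@ex_diff _ _ _ _ _ _ _ (did u)).
suff -> : (fun u : 'rV[R]_k => 'd (fun u => u) u v) = (fun _ => v).
  exact: Cn_cst.
by apply/funext => u; exact: (f_equal (@^~ v) (@diff_val _ _ _ _ _ _ _ (did u))).
Qed.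

Lemma CnD m k n (U : set 'rV[R]_k) (f g : 'rV[R]_k -> 'rV[R]_n) :
  open U -> Cn m U f -> Cn m U g -> Cn m U (fun u => f u + g u).
Proof.
move=> oU; elim: m f g => [|m IH] f g.
  by move=> cf cg u Uu; apply: continuousD; [exact: cf|exact: cg].
move=> [df dvf] [dg dvg].
split=> [u Uu|v]; first by apply: differentiableD; [exact: df|exact: dg].
apply: eq_Cn (IH _ _ (dvf v) (dvg v)) => // u Uu.
exact: (esym (f_equal (@^~ v) (diffD (df u Uu) (dg u Uu)))).
Qed.

Lemma Cn_sum m k n (I : Type) (r : seq I) (U : set 'rV[R]_k)
    (f : I -> 'rV[R]_k -> 'rV[R]_n) :
  open U -> (forall i, Cn m U (f i)) -> Cn m U (fun u => \sum_(i <- r) f i u).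
Proof.
move=> oU Cf; elim: r => [|i r IH].
  by apply: (eq_Cn oU _ (Cn_cst m U 0)) => u _; rewrite big_nil.
apply: (eq_Cn oU _ (CnD oU (Cf i) IH)) => u _.
by rewrite big_cons.
Qed.

(** The product rule gives two products of the same form, in which [CnS] lowers the order of the
    undifferentiated factor. Sums of such products express both matrix multiplication and the chain
    rule. *)
Lemma Cn_coordZ m k l n (U : set 'rV[R]_k) (a : 'rV[R]_k -> 'rV[R]_l)
    (b : 'rV[R]_k -> 'rV[R]_n) (j : 'I_l) :
  open U -> Cn m U a -> Cn m U b -> Cn m U (fun u => a u ord0 j *: b u).
Proof.
move=> oU; elim: m a b => [|m IH] a b.
  move=> ca cb u Uu; apply: continuousZ; last exact: cb.
  apply: (@continuous_comp _ _ _ a (fun M : 'rV[R]_l => M ord0 j)); first exact: ca.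
  exact: coord_continuous.
move=> Ca Cb; have [[da dva] [db dvb]] := (Ca, Cb).
pose ab u := (a u ord0 j : R^o, b u).
(* A coordinate is a continuous linear form, hence its own differential. *)
have dco (M : 'rV[R]_l) : is_diff M (fun N : 'rV[R]_l => N ord0 j : R^o)
    (fun N => N ord0 j).
  have lc : linear (fun N : 'rV[R]_l => N ord0 j : R^o).
    by move=> c x y; rewrite !mxE.
  pose cM := GRing.isLinear.Build _ _ _ _ _ lc.
  pose cL : {linear _ -> _} := HB.pack (fun N : 'rV[R]_l => N ord0 j : R^o) cM.
  have cc : continuous cL by exact: coord_continuous.
  by apply: DiffDef; [exact: (linear_differentiable M cc)|exact: (diff_lin M cc)].
have dE u : U u -> is_diff u (fun u => a u ord0 j *: b u)
    (fun v => a u ord0 j *: 'd b u v + 'd a u v ord0 j *: b u).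
  move=> Uu.
  have Da := differentiableP (da u Uu); have Db := differentiableP (db u Uu).
  have D1 := is_diff_comp Da (dco (a u)).
  exact: (is_diff_comp (is_diff_pair D1 Db) (is_diff_scale (ab u))).
split=> [u /dE D|v]; first exact: (@ex_diff _ _ _ _ _ _ _ D).
apply: eq_Cn (CnD oU (IH _ _ (CnS Ca) (dvb v)) (IH _ _ (dva v) (CnS Cb))) => //.
move=> u /dE D; exact: (esym (f_equal (@^~ v) (@diff_val _ _ _ _ _ _ _ D))).
Qed.

Lemma Cn_mulmx m k n (U : set 'rV[R]_k) (B : 'M[R]_(k, n)) :
  open U -> Cn m U (fun u => u *m B).
Proof.
move=> oU.
have := Cn_sum (enum 'I_k) oU
  (fun i => Cn_coordZ i oU (Cn_id m U) (Cn_cst m U (row i B))).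
by apply: eq_Cn => // u _; rewrite mulmx_sum_row -big_enum.
Qed.

Lemma Cn_comp m k l n (U : set 'rV[R]_k) (V : set 'rV[R]_l)
    (g : 'rV[R]_k -> 'rV[R]_l) (f : 'rV[R]_l -> 'rV[R]_n) :
  open U -> (forall u, U u -> V (g u)) -> Cn m U g -> Cn m V f ->
  Cn m U (fun u => f (g u)).
Proof.
move=> oU UV; elim: m f => [|m IH] f.
  move=> cg cf u Uu.
  by apply: continuous_comp; [exact: cg|exact/cf/UV].
move=> Cg Cf; have [[dg dvg] [df dvf]] := (Cg, Cf).
split=> [u Uu|v]; first by apply: differentiable_comp; [exact: dg|exact/df/UV].
(* Chain rule: the derivative along v is the sum over j of the j-th coordinate of ['d g u v] times
   the j-th partial derivative of f at g u, and [IH] applies to the latter. *)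
have := Cn_sum (enum 'I_l) oU (fun j => Cn_coordZ j oU (dvg v)
  (IH _ (CnS Cg) (dvf (delta_mx ord0 j)))).
apply: eq_Cn => // u Uu.
rewrite [RHS](f_equal (@^~ v) (diff_comp (dg u Uu) (df _ (UV _ Uu)))) /=.
rewrite [in RHS](row_sum_delta ('d g u v)) linear_sum big_enum /=.
by apply: eq_bigr => j _; rewrite linearZ.
Qed.

End Cn_theory.

Section SmoothOn.
Variable R : realType.

Lemma smooth_on_continuous k n (U : set 'rV[R]_k) (f : 'rV[R]_k -> 'rV[R]_n) u :
  smooth_on U f -> U u -> {for u, continuous f}.
Proof. by move=> /(_ 0%N); exact. Qed.

Lemma smooth_on_differentiable k n (U : set 'rV[R]_k)
    (f : 'rV[R]_k -> 'rV[R]_n) u :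
  smooth_on U f -> U u -> differentiable f u.
Proof. by move=> /(_ 1%N)[df _]; exact: df. Qed.

Lemma smooth_on_cover k n (U : set 'rV[R]_k) (f : 'rV[R]_k -> 'rV[R]_n) :
  (forall u, U u -> exists2 W : set 'rV[R]_k, W u & smooth_on W f) ->
  smooth_on U f.
Proof. by move=> cov m; apply: Cn_cover => u /cov[W ? fW]; exists W. Qed.

Lemma smooth_on_subset k n (U W : set 'rV[R]_k) (f : 'rV[R]_k -> 'rV[R]_n) :
  U `<=` W -> smooth_on W f -> smooth_on U f.
Proof. by move=> UW sf m; exact: Cn_subset (sf m). Qed.

Lemma eq_smooth_on k n (U : set 'rV[R]_k) (f g : 'rV[R]_k -> 'rV[R]_n) :
  open U -> (forall u, U u -> f u = g u) -> smooth_on U f -> smooth_on U g.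
Proof. by move=> oU fg sf m; exact: eq_Cn (sf m). Qed.

Lemma smooth_on_comp k l n (U : set 'rV[R]_k) (V : set 'rV[R]_l)
    (g : 'rV[R]_k -> 'rV[R]_l) (f : 'rV[R]_l -> 'rV[R]_n) :
  open U -> (forall u, U u -> V (g u)) -> smooth_on U g -> smooth_on V f ->
  smooth_on U (fun u => f (g u)).
Proof. by move=> oU UV sg sf m; exact: Cn_comp (sg m) (sf m). Qed.

Lemma smooth_on_mulmx k n (B : 'M[R]_(k, n)) : smooth_on setT (mulmx^~ B).
Proof. by move=> m; apply: Cn_mulmx; exact: openT. Qed.

Lemma open_smooth_preimage k n (U : set 'rV[R]_k) (V : set 'rV[R]_n)
    (f : 'rV[R]_k -> 'rV[R]_n) :
  open U -> open V -> smooth_on U f -> open [set u | U u /\ V (f u)].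
Proof.
move=> oU oV sf; rewrite openE => u [Uu Vfu].
have := smooth_on_continuous sf Uu (open_nbhs_nbhs (conj oV Vfu)).
by move=> Vf; apply: filterI => //; exact: open_nbhs_nbhs.
Qed.

End SmoothOn.

(** * Plots of manifolds *)

Local Arguments pdom {R T} p.
Local Arguments pmap {R T} p.
Local Arguments atlas {R} m.
Local Arguments rep_dom {R S T} f p q _.
Local Arguments plot {R} M p.
Local Arguments chart {R} M p.
Local Arguments lc_map {R G x} l.
Local Arguments lc_act {R G x} l.
Local Arguments lc_arr {R G x} l.

Section Plots.
Variable R : realType.
Implicit Types M N P : mfd R.

Definition inj_param T (p : param R T) :=
  forall u v, pdom p u -> pdom p v -> pmap p u = pmap p v -> u = v.

Definition covered M :=
  (forall p, atlas M p -> open (pdom p)) /\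
  forall x, exists2 p, atlas M p & exists2 u, pdom p u & pmap p u = x.

(** Smoothness tested on all plots rather than on an atlas; in this form maps compose at once. *)
Definition plot_preserving M N (f : carrier M -> carrier N) :=
  forall p, plot M p -> plot N (comp_param f p).

(** Local representatives glue because injectivity of q leaves a single possible value at each
    point. *)
Lemma smooth_rep_local S T (f : S -> T) (p : param R S) (q : param R T) :
  inj_param q ->
  (forall u, rep_dom f p q u -> exists (W : set _) (g : 'rV[R]_(pdim p) -> _),
    [/\ open W, W u, W `<=` pdom p, smooth_on W g & forall u', W u' ->
      pdom q (g u') /\ pmap q (g u') = f (pmap p u')]) ->
  smooth_rep f p q.
Proof.
move=> qI loc; split.
  rewrite openE => u /loc[W [g [oW Wu Wp _ Wg]]].
  rewrite /interior; apply: filterS (open_nbhs_nbhs (conj oW Wu)) => u' Wu'.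
  by split; [exact: Wp|exists (g u'); have [] := Wg u' Wu'].
(* The value 0 outside the domain of representation is arbitrary. *)
have /choice[g gP] : forall u, exists v, rep_dom f p q u ->
    pdom q v /\ pmap q v = f (pmap p u).
  move=> u; have [[_ [v qv vE]]|nu] := pselect (rep_dom f p q u).
    by exists v.
  by exists 0.
exists g; split=> // ; apply: smooth_on_cover => u /loc[W [h [oW Wu Wp sh Wh]]].
exists W => //; apply: eq_smooth_on sh => // u' Wu'.
have [qh hE] := Wh u' Wu'.
have [|qg gE] := gP u'; first by split; [exact: Wp|exists (h u')].
by apply: qI => //; rewrite hE gE.
Qed.

Lemma plot_precomp M (p : param R (carrier M)) k (U : set 'rV[R]_k)
    (h : 'rV[R]_k -> 'rV[R]_(pdim p)) :
  plot M p -> open U -> smooth_on U h -> (forall u, U u -> pdom p (h u)) ->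
  plot M (Param U (pmap p \o h)).
Proof.
move=> [op sp] oU sh Uh; split=> // q Mq.
have [oq [g [sg gP]]] := sp q Mq.
have dE : rep_dom id (Param U (pmap p \o h)) q =
    [set u | U u /\ rep_dom id p q (h u)].
  apply/seteqP; split=> u /= [Uu]; first by move=> qu; split=> //; split=> //; exact: Uh.
  by move=> [_ qu].
split; first by rewrite dE; exact: open_smooth_preimage.
exists (g \o h); split; last first.
  by move=> u; rewrite dE => -[Uu]; exact: gP.
rewrite dE; apply: smooth_on_comp sg; first exact: open_smooth_preimage.
  by move=> u [].
by apply: smooth_on_subset sh => u [].
Qed.

(** Near a given parameter a plot p factors through some r in the atlas of M. The coordinate form h
    of p in r, followed by the coordinate form k of f o r in q, represents f o p. *)
Lemma covered_plot_preserving M N (f : carrier M -> carrier N) :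
  covered M -> (forall q, atlas N q -> inj_param q) ->
  (forall p, atlas M p -> plot N (comp_param f p)) ->
  plot_preserving f.
Proof.
move=> [_ covM] injN fM p [op sp]; split=> // q Nq.
apply: smooth_rep_local; first exact: injN.
move=> u [pu [v qv vE]].
have [r Mr [w rw wE]] := covM (pmap p u).
have [oh [h [sh hP]]] := sp r Mr.
have [_ /(_ q Nq)[ok [k [sk kP]]]] := fM r Mr.
pose W := [set u | rep_dom id p r u /\ rep_dom id (comp_param f r) q (h u)].
have Wu : W u.
  have ru : rep_dom id p r u by split=> //; exists w.
  split=> //; split; first by have [] := hP u ru.
  by exists v => //; rewrite vE /=; have [_ ->] := hP u ru.
exists W, (k \o h); split=> //; first exact: open_smooth_preimage.
- by move=> u' [[]].
- apply: smooth_on_comp sk => [|u' []//|]; first exact: open_smooth_preimage.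
  by apply: smooth_on_subset sh => u' [].
- move=> u' [/hP[_ hE] /kP[qk kE]]; split=> //=.
  by rewrite kE /= hE.
Qed.

Lemma smooth_plot M N (f : carrier M -> carrier N) p :
  smooth f -> atlas M p -> open (pdom p) -> plot N (comp_param f p).
Proof. by move=> sf Mp op; split=> // q Nq; exact: (sf p q Mp Nq). Qed.

Lemma plot_smooth M N (f : carrier M -> carrier N) :
  (forall p, atlas M p -> plot N (comp_param f p)) -> smooth f.
Proof. by move=> fM p q Mp Nq; have [_ /(_ q Nq)] := fM p Mp. Qed.

Lemma chart_plot M c : chart M c -> plot M c.
Proof. by move=> [oc _ sc]; split=> // q /sc[]. Qed.

Lemma manifold_covered M : is_manifold M -> covered M.
Proof. by move=> [cM covM _ _]; split=> // p /cM[]. Qed.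

Lemma manifold_inj M : is_manifold M -> forall q, atlas M q -> inj_param q.
Proof. by move=> [cM _ _ _] p /cM[]. Qed.

Lemma manifold_plot M : is_manifold M -> forall q, atlas M q -> plot M q.
Proof. by move=> [cM _ _ _] p /cM; exact: chart_plot. Qed.

Lemma smooth_plot_preserving M N (f : carrier M -> carrier N) :
  is_manifold M -> is_manifold N -> smooth f -> plot_preserving f.
Proof.
move=> mM mN sf; apply: covered_plot_preserving.
- exact: manifold_covered.
- exact: manifold_inj.
- by move=> p Mp; apply: smooth_plot => //; exact: (manifold_covered mM).1.
Qed.

Lemma plot_chart_rep M p c :
  covered M -> chart M c -> plot M p -> smooth_rep id p c.
Proof.
move=> cM [oc ic sc] Mp.
(* The chart c need not belong to the atlas of M; it is made the whole atlas of a second structure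
   on the same set, into which the identity preserves plots. *)
have pp : @plot_preserving M (Mfd [set c]) id.
  apply: covered_plot_preserving => // [q ->//|q Mq].
  split; first exact: (cM.1 q Mq).
  by move=> _ ->; exact: (sc q Mq).2.
by have [_ /(_ c erefl)] := pp p Mp.
Qed.

Section Fibprod.
Variables (X Y : mfd R) (Z : Type) (f : carrier X -> Z) (g : carrier Y -> Z).
Let T := carrier (fibprod f g).

Definition fib_fst (t : T) : carrier X := (sval t).1.
Definition fib_snd (t : T) : carrier Y := (sval t).2.

(** The third clause of [plot_atlas] provides the smooth representatives directly. *)
Lemma plot_fibprod (p : param R T) :
  plot X (comp_param fib_fst p) -> plot Y (comp_param fib_snd p) ->
  plot (fibprod f g) p.
Proof. by move=> pX pY; split=> [|q [_ _]]; [have [] := pX|exact]. Qed.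

Lemma fib_fst_plot_preserving :
  covered (fibprod f g) -> (forall q, atlas X q -> inj_param q) ->
  plot_preserving fib_fst.
Proof. by move=> cov inj; apply: covered_plot_preserving => // p [[]]. Qed.

Lemma fib_snd_plot_preserving :
  covered (fibprod f g) -> (forall q, atlas Y q -> inj_param q) ->
  plot_preserving fib_snd.
Proof. by move=> cov inj; apply: covered_plot_preserving => // p [[]]. Qed.

End Fibprod.

End Plots.

(** * Submersions transported along diffeomorphisms *)

Section Transfer.
Variable R : realType.

(** In coordinates f' is f o i followed by j, and the differential of j is onto because j o j' is
    the identity. Since submersions are tested on atlases, i is only asked to carry one atlas into
    the other. *)
Lemma submersion_transfer (P P' N N' : mfd R) (f : carrier P -> carrier N)
    (f' : carrier P' -> carrier N') (i : carrier P' -> carrier P)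
    (j : carrier N -> carrier N') (j' : carrier N' -> carrier N) :
  is_manifold N -> is_manifold N' ->
  plot_preserving j -> plot_preserving j' -> cancel j j' -> cancel j' j ->
  (forall p, atlas P' p -> atlas P (comp_param i p)) ->
  (forall x, j (f (i x)) = f' x) ->
  submersion f -> smooth f' -> submersion f'.
Proof.
move=> mN mN' pj pj' jK j'K Pi fE [sf df] sf'; split=> // p q Pp Nq g [sg gP] u fu.
have [_ covN] := manifold_covered mN.
(* With r around the image point, h is the coordinate form of f o i, and t and s are those of j and
   j'. *)
have [r Nr [x rx xE]] := covN (f (i (pmap p u))).
have [oh [h [sh hP]]] := sf _ r (Pi p Pp) Nr.
have [_ /(_ q Nq)[ot [t [st tP]]]] := pj r (manifold_plot mN Nr).
have [_ /(_ r Nr)[os [s [ss sP]]]] := pj' q (manifold_plot mN' Nq).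
have hu : rep_dom f (comp_param i p) r u by split; [exact: fu.1|exists x].
have [qgu guE] := gP u fu; have [rhu huE] := hP u hu.
have tu : rep_dom id (comp_param j r) q (h u).
  by split=> //; exists (g u) => //=; rewrite guE huE /= fE.
have su : rep_dom id (comp_param j' q) r (g u).
  by split=> //; exists x => //=; rewrite xE guE -fE jK.
have suE : s (g u) = h u.
  have [rs sE] := sP _ su; apply: (manifold_inj mN Nr) => //.
  by rewrite sE huE /= guE -fE jK.
have [dh ds] := (smooth_on_differentiable sh hu, smooth_on_differentiable ss su).
have dt := smooth_on_differentiable st tu.
(* Near u, injectivity of q forces g = t o h. *)
have [_ gE] : differentiable g u /\ 'd g u = 'd (t \o h) u :> (_ -> _).
  apply: near_eq_differentiable; last exact: differentiable_comp.
  have := conj (open_smooth_preimage oh ot sh) (conj hu tu).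
  move/open_nbhs_nbhs; apply: filterS => u' [/= hu' tu'].
  have [qt tE] := tP _ tu'; have [_ hE] := hP _ hu'.
  have tE' : pmap q (t (h u')) = f' (pmap p u') by rewrite tE /= hE /= fE.
  have [|qg gE] := gP u'; first by split; [exact: hu'.1|exists (t (h u'))].
  by apply: (manifold_inj mN' Nq) => //; rewrite tE' gE.
(* Near g u the composite t o s is the identity, so the differential of s is a right inverse of that
   of t. *)
have [_ idE] : differentiable id (g u) /\ 'd id (g u) = 'd (t \o s) (g u) :> (_ -> _).
  apply: near_eq_differentiable; last by apply: differentiable_comp; rewrite ?suE.
  have tu' : rep_dom id (comp_param j r) q (s (g u)) by rewrite suE.
  have := conj (open_smooth_preimage os ot ss) (conj su tu').
  move/open_nbhs_nbhs; apply: filterS => z [/= sz tz].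
  have [qt tE] := tP _ tz; have [_ sE] := sP _ sz.
  have tsE : pmap q (t (s z)) = pmap q z by rewrite tE /= sE /= j'K.
  exact: (manifold_inj mN' Nq qt sz.1 tsE).
(* The vector v is a preimage under ['d h u] of ['d s (g u) w], which the differential of t sends
   back to w. *)
move=> w; have [v vE] := df _ r (Pi p Pp) Nr h (conj sh hP) u hu ('d s (g u) w).
exists v; rewrite [LHS](f_equal (@^~ v) gE).
rewrite [LHS](f_equal (@^~ v) (diff_comp dh dt)) /= vE -suE.
have dt' : differentiable t (s (g u)) by rewrite suE.
rewrite -[LHS](f_equal (@^~ w) (diff_comp ds dt')).
rewrite -[LHS](f_equal (@^~ w) idE).
exact: (f_equal (@^~ w) (@diff_val _ _ _ _ _ _ _ (is_diff_id (g u)))).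
Qed.

End Transfer.

(** * Plots of sector groupoids *)

Lemma comp_idem (G : groupoid) (g : arr G) (e : src g = tgt g) :
  comp g g e = g -> g = idn (src g).
Proof.
move=> gg.
have e1 : src (inv g) = tgt g by rewrite src_inv.
have e2 : src (inv g) = tgt (comp g g e) by rewrite tgt_comp.
have e3 : src (comp (inv g) g e1) = tgt g by rewrite src_comp.
rewrite -(comp_invl e1) -(comp_congr e2 e1 erefl gg) (compA e1 e e2 e3).
have e4 : src (idn (src g)) = tgt g by rewrite src_idn.
by rewrite (comp_congr e3 e4 (comp_invl e1) erefl) comp_idl_at.
Qed.

Section GhomLemmas.
Variables (Gam : groupType) (G : groupoid) (f : ghom Gam G).

Lemma hfun_composable a b : src (hfun f a) = tgt (hfun f b).
Proof. by rewrite (hiso f a).1 (hiso f b).2. Qed.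

Lemma hfun1 : hfun f 1%g = idn (base f).
Proof.
have := hmul (hfun_composable 1%g 1%g); rewrite mulg1.
by move/esym/comp_idem; rewrite (hiso f _).1.
Qed.

Lemma hfunV a : hfun f a^-1%g = inv (hfun f a).
Proof.
apply: (inv_unique (e := hfun_composable _ _)).
by rewrite -hmul mulVg hfun1 (hiso f a).1.
Qed.

End GhomLemmas.

(** The condition that [finitely_generated] puts on its list, in a form that serves as an induction
    principle. *)
Definition generates (Gam : groupType) (s : seq Gam) :=
  forall P : Gam -> Prop,
    P 1%g -> (forall a b, P a -> P b -> P (a * b)%g) ->
    (forall a, P a -> P a^-1%g) -> (forall a, a \in s -> P a) ->
    forall a, P a.

Section SectorPlots.
Variables (R : realType) (Gam : groupType) (G : gpd_with_atlases R).
Implicit Types phi psi : ghom Gam G.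

Local Notation S := (sector_lie_groupoid Gam G).

Lemma lc_map_inj (x : ob G) (L : linear_chart x) : injective (lc_map L).
Proof. by move=> u v uv; have [_ /(_ u v)->] := lc_chart L. Qed.

(** The identity acts trivially, so [lc_arr_comp] makes this arrow idempotent, and an idempotent
    arrow of a groupoid is an identity. *)
Lemma lc_arr_idn (x : ob G) (L : linear_chart x) u :
  lc_arr L (idn x) u = idn (lc_map L u).
Proof.
have ix : isotropy x (idn x) by split; rewrite ?src_idn ?tgt_idn.
have e : src (idn x) = tgt (idn x) by rewrite ix.1 ix.2.
have e1 : src (lc_arr L (idn x) u) = tgt (lc_arr L (idn x) u).
  by rewrite lc_src // lc_tgt // lc_act_idn.
have e2 : src (lc_arr L (idn x) (lc_act L (idn x) u)) = tgt (lc_arr L (idn x) u).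
  by rewrite lc_act_idn.
have := lc_arr_comp e e2 ix ix; rewrite comp_idl_at => E.
have /comp_idem : comp _ _ e1 = lc_arr L (idn x) u.
  by rewrite [RHS]E; apply: comp_congr; rewrite ?lc_act_idn.
by rewrite lc_src.
Qed.

(** The set of a for which the equality holds is closed under the group operations: there phi a
    fixes v, so [lc_arr_comp] composes the arrows over v without moving the base point. *)
Lemma ghom_lc_arr (s : seq Gam) phi (L : linear_chart (base phi)) psi v :
  generates s -> base psi = lc_map L v ->
  (forall a, a \in s -> exists w, lc_arr L (hfun phi a) w = hfun psi a) ->
  forall a, hfun psi a = lc_arr L (hfun phi a) v.
Proof.
move=> gs bE sE.
(* As psi a is a loop at [lc_map L v], comparing targets shows that phi a fixes v. *)
have fixv a : hfun psi a = lc_arr L (hfun phi a) v -> lc_act L (hfun phi a) v = v.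
  move=> aE; apply: (@lc_map_inj _ L).
  by rewrite -(lc_tgt _ (hiso phi a)) -aE (hiso psi a).2.
have mulE a b : hfun psi b = lc_arr L (hfun phi b) v ->
    forall e : src (lc_arr L (hfun phi a) v) = tgt (hfun psi b),
    lc_arr L (hfun phi (a * b)%g) v = comp (lc_arr L (hfun phi a) v) (hfun psi b) e.
  move=> bE' e; rewrite (hmul (hfun_composable _ a b)).
  have e' : src (lc_arr L (hfun phi a) (lc_act L (hfun phi b) v)) =
      tgt (lc_arr L (hfun phi b) v) by rewrite fixv // e bE'.
  rewrite (lc_arr_comp _ e' (hiso phi a) (hiso phi b)).
  by apply: comp_congr; rewrite ?fixv.
apply: gs => [|a b aE bE'|a aE|a /sE[w wE]].
- by rewrite !hfun1 bE lc_arr_idn.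
- have e : src (lc_arr L (hfun phi a) v) = tgt (hfun psi b).
    by rewrite -aE; exact: hfun_composable.
  rewrite (mulE _ _ bE' e) (hmul (hfun_composable _ a b)).
  exact: comp_congr.
- have e : src (lc_arr L (hfun phi a^-1%g) v) = tgt (hfun psi a).
    by rewrite lc_src ?(hiso psi a).2 //; exact: hiso.
  rewrite hfunV; apply/esym/(inv_unique (e := e)).
  by rewrite -mulE // mulVg hfun1 lc_arr_idn (hiso psi a).1 bE.
(* For a generator only some w is given; comparing sources yields w = v. *)
- rewrite -wE; congr (lc_arr L _ _); apply: (@lc_map_inj _ L).
  by rewrite -bE -(hiso psi a).1 -wE lc_src //; exact: hiso.
Qed.

(** Finiteness of the generating list enters here: the conditions on all generators together still
    define an open set. *)
Lemma open_all_in (T : topologicalType) (I : eqType) (s : seq I) (F : I -> set T) :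
  (forall a, a \in s -> open (F a)) -> open [set u | forall a, a \in s -> F a u].
Proof.
elim: s => [|a s IH] oF.
  by rewrite (_ : [set _ | _] = setT); [exact: openT|apply/seteqP; split].
rewrite (_ : [set _ | _] = F a `&` [set u | forall b, b \in s -> F b u]).
  apply: openI; first by apply: oF; rewrite mem_head.
  by apply: IH => b bs; apply: oF; rewrite inE bs orbT.
apply/seteqP; split=> u /= H.
  by split=> [|b bs]; apply: H; rewrite inE ?eqxx ?bs ?orbT.
by move=> b; rewrite inE => /orP[/eqP->|]; [exact: H.1|exact: H.2].
Qed.

(* Near a parameter where p meets a chart kappa around phi, the coordinate of *)
(* p in the linear chart is the only unknown: the arrows of generators lie in *)
(* the sheets through phi, and ghom_lc_arr extends this to all of Gam.        *)
Lemma plot_sector (s : seq Gam) (p : param R (ghom Gam G)) :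
  generates s -> covered (obm G) -> covered (arrm G) ->
  plot (obm G) (comp_param (@base Gam G) p) ->
  (forall a, a \in s -> plot (arrm G) (comp_param (fun f => hfun f a) p)) ->
  plot (obm S) p.
Proof.
move=> gs covO covA bp hp; split=> [|q]; first by have [] := bp.
move=> [phi [L [B [Bfree fixE qT bE hE]]]].
(* The rows of B are independent, so [pinvmx B] recovers w from its coordinates in the linear
   chart. *)
have binv w : w *m B *m pinvmx B = w.
  by rewrite -mulmxA mulmxVp ?mulmx1.
have [oW [g [sg gP]]] := plot_chart_rep covO (lc_chart L) bp.
pose W := [set u | rep_dom id (comp_param (@base Gam G) p)
    (Param setT (lc_map L)) u] `&`
    [set u : 'rV[R]_(pdim p) | forall a, a \in s ->
    rep_dom id (comp_param (fun f => hfun f a) p)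
      (Param setT (lc_arr L (hfun phi a))) u].
have oWW : open W.
  apply: openI; first exact: oW.
  apply: open_all_in => a sa.
  by have [] := plot_chart_rep covA (lc_arr_chart L (hiso phi a)) (hp a sa).
apply: smooth_rep_local.
  move=> w w' _ _ ww'; rewrite -[w]binv -[w']binv; congr (_ *m _).
  by apply: (@lc_map_inj _ L); rewrite -!bE ww'.
move=> u [pu [w _ wE]].
exists W, (fun u => g u *m pinvmx B); split=> //.
- split; first by split=> //; exists (w *m B) => //=; rewrite -bE wE.
  by move=> a sa; split=> //; exists (w *m B) => //=; rewrite -hE wE.
- by move=> u' [[]].
- apply: smooth_on_comp (@smooth_on_mulmx R _ _ (pinvmx B)) => //.
  by apply: smooth_on_subset sg => u' [].
move=> u' [bu' hu']; have [_ /= gE] := gP u' bu'.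
have hE' : forall a, hfun (pmap p u') a = lc_arr L (hfun phi a) (g u').
  apply: (ghom_lc_arr gs) => [|a sa]; first by rewrite gE.
  by have [_ [v _ vE]] := hu' a sa; exists v.
(* The values of a homomorphism are loops, so g u' is fixed by every [hfun phi a]. It therefore lies
   in the row space of B, where applying [pinvmx B] and then B changes nothing. *)
have /mulmxKpV gB : (g u' <= B)%MS.
  apply/fixE => a; apply: (@lc_map_inj _ L).
  by rewrite -(lc_tgt _ (hiso phi a)) -hE' (hiso _ a).2 gE.
split; first by rewrite qT.
by apply: ghom_eq => [|a]; rewrite ?bE ?hE gB.
Qed.

(** In a kappa chart the base point is the linear map given by B followed by [lc_map L]; values at
    group elements factor likewise through [lc_arr L]. *)
Lemma kappa_plot_base p :
  kappa_atlas p -> plot (obm G) (comp_param (@base Gam G) p).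
Proof.
move=> [phi [L [B [_ _ qT bE _]]]].
have -> : comp_param (@base Gam G) p =
    Param (pdom p) (pmap (Param setT (lc_map L)) \o mulmx^~ B).
  by congr Param; apply/funext => w /=; rewrite bE.
apply: plot_precomp => //; first exact/chart_plot/lc_chart.
  by rewrite qT; exact: openT.
exact: smooth_on_subset (@smooth_on_mulmx R _ _ B).
Qed.

Lemma kappa_plot_hfun a p :
  kappa_atlas p -> plot (arrm G) (comp_param (fun f : ghom Gam G => hfun f a) p).
Proof.
move=> [phi [L [B [_ _ qT _ hE]]]].
have -> : comp_param (fun f : ghom Gam G => hfun f a) p =
    Param (pdom p) (pmap (Param setT (lc_arr L (hfun phi a))) \o mulmx^~ B).
  by congr Param; apply/funext => w /=; rewrite hE.
apply: plot_precomp => //; first exact/chart_plot/lc_arr_chart/hiso.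
  by rewrite qT; exact: openT.
exact: smooth_on_subset (@smooth_on_mulmx R _ _ B).
Qed.

Hypotheses (lieG : lie_groupoid G) (lieS : lie_groupoid S).

(** Together with [hfun_plot_preserving], a converse to [plot_sector]. *)
Lemma base_plot_preserving : @plot_preserving R (obm S) (obm G) (@base Gam G).
Proof.
have [[mO _] _ _ _ _] := lieG; have [[mS _] _ _ _ _] := lieS.
apply: covered_plot_preserving => [|q|p]; first exact: manifold_covered.
- exact: manifold_inj.
- exact: kappa_plot_base.
Qed.

Lemma hfun_plot_preserving a :
  @plot_preserving R (obm S) (arrm G) (fun f : ghom Gam G => hfun f a).
Proof.
have [[_ mA] _ _ _ _] := lieG; have [[mS _] _ _ _ _] := lieS.
apply: covered_plot_preserving => [|q|p]; first exact: manifold_covered.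
- exact: manifold_inj.
- exact: kappa_plot_hfun.
Qed.

Lemma sector_arr_fst_plot_preserving :
  @plot_preserving R (arrm S) (arrm G) (fun t : arr S => (sval t).1).
Proof.
have [[_ mA] _ _ _ _] := lieG; have [[_ mS] _ _ _ _] := lieS.
exact: (@fib_fst_plot_preserving R (arrm G) (Mfd (@kappa_atlas R Gam G)) _
  (@src G) (@base Gam G) (manifold_covered mS) (manifold_inj mA)).
Qed.

Lemma sector_arr_snd_plot_preserving :
  @plot_preserving R (arrm S) (obm S) (fun t : arr S => (sval t).2).
Proof.
have [[mO mS] _ _ _ _] := lieS.
exact: (@fib_snd_plot_preserving R (arrm G) (Mfd (@kappa_atlas R Gam G)) _
  (@src G) (@base Gam G) (manifold_covered mS) (manifold_inj mO)).
Qed.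

Lemma plot_sector_arr (p : param R (arr S)) :
  plot (arrm G) (comp_param (fun t : arr S => (sval t).1) p) ->
  plot (obm S) (comp_param (fun t : arr S => (sval t).2) p) ->
  plot (arrm S) p.
Proof.
exact: (@plot_fibprod R (arrm G) (Mfd (@kappa_atlas R Gam G)) _
  (@src G) (@base Gam G)).
Qed.

End SectorPlots.

(** * The isomorphism of iterated sector groupoids *)

Section Cmp.
Variable G : groupoid.
Implicit Types g h k : arr G.

(* Made total so as to rewrite with arrows without transporting proofs of     *)
(* composability; the value g off composable pairs is junk.                   *)
Definition cmp g h : arr G :=
  if pselect (src g = tgt h) is left e then comp g h e else g.

Lemma cmpE g h (e : src g = tgt h) : comp g h e = cmp g h.
Proof. by rewrite /cmp; case: pselect => // e'; exact: comp_congr. Qed.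

Lemma src_cmp g h : src g = tgt h -> src (cmp g h) = src h.
Proof. by move=> e; rewrite -cmpE src_comp. Qed.

Lemma tgt_cmp g h : src g = tgt h -> tgt (cmp g h) = tgt g.
Proof. by move=> e; rewrite -cmpE tgt_comp. Qed.

Lemma cmpA g h k : src g = tgt h -> src h = tgt k ->
  cmp g (cmp h k) = cmp (cmp g h) k.
Proof.
move=> e1 e2; rewrite -(cmpE e1) -(cmpE e2).
have e3 : src g = tgt (comp h k e2) by rewrite tgt_comp.
have e4 : src (comp g h e1) = tgt k by rewrite src_comp.
by rewrite -(cmpE e3) -(cmpE e4); exact: compA.
Qed.

Lemma cmp1g x g : x = tgt g -> cmp (idn x) g = g.
Proof.
move=> e; have e' : src (idn x) = tgt g by rewrite src_idn.
by rewrite -(cmpE e') comp_idl_at.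
Qed.

Lemma cmpg1 x g : src g = x -> cmp g (idn x) = g.
Proof.
move=> e; have e' : src g = tgt (idn x) by rewrite tgt_idn.
by rewrite -(cmpE e') comp_idr_at.
Qed.

Lemma cmpVg g : cmp (inv g) g = idn (src g).
Proof. by rewrite -(cmpE (src_inv g)) comp_invl. Qed.

Lemma cmpKVg g h : src h = src g -> cmp (cmp h (inv g)) g = h.
Proof.
move=> e; rewrite -cmpA ?src_inv ?tgt_inv //.
by rewrite cmpVg cmpg1.
Qed.

Lemma hfunM (Gam : groupType) (f : ghom Gam G) a b :
  hfun f (a * b)%g = cmp (hfun f a) (hfun f b).
Proof. by rewrite (hmul (hfun_composable f a b)) cmpE. Qed.

Lemma conj_funE (Gam : groupType) (f : ghom Gam G) h (e : src h = base f) a :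
  conj_fun e a = cmp (cmp h (hfun f a)) (inv h).
Proof. by rewrite /conj_fun !cmpE. Qed.

End Cmp.

(** This and [hfun_tgt] hold by computation; as rewriting rules they avoid unfolding nested
    translation groupoids. *)
Lemma base_tgt (Gam : groupType) (G : groupoid) (t : arr (sector_groupoid Gam G)) :
  base (tgt t) = tgt (sval t).1.
Proof. by []. Qed.

Lemma hfun_tgt (Gam : groupType) (G : groupoid) (t : arr (sector_groupoid Gam G)) a :
  hfun (tgt t) a = conj_fun (proj2_sig t) a.
Proof. by []. Qed.

Lemma fst_comp (Gam : groupType) (G : groupoid) (t u : arr (sector_groupoid Gam G))
    (e : src t = tgt u) :
  (sval (comp t u e)).1 = cmp (sval t).1 (sval u).1.
Proof. exact: cmpE. Qed.

Section Iterated.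
Variables (Gam1 Gam2 : groupType) (G : groupoid).

Local Notation Gam12 := (Gam1 * Gam2)%type.
Local Notation S1 := (sector_groupoid Gam1 G).
Local Notation S12 := (sector_groupoid Gam12 G).
Local Notation S2S1 := (sector_groupoid Gam2 S1).

Section Merge.
Variable f : ghom Gam2 S1.

Let f1 : ghom Gam1 G := base f.

(** The other component of [hfun f b] is always [f1], so [f1] and these arrows of G determine f. *)
Definition arr2 (b : Gam2) : arr G := (sval (hfun f b)).1.

Lemma hfun_snd b : (sval (hfun f b)).2 = f1.
Proof. exact: (hiso f b).1. Qed.

Lemma src_arr2 b : src (arr2 b) = base f1.
Proof. by rewrite /arr2 (proj2_sig (hfun f b)) -(hfun_snd b). Qed.

Lemma tgt_arr2 b : tgt (arr2 b) = base f1.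
Proof. by rewrite /f1 -(hiso f b).2. Qed.

(** An arrow of [S1] from f1 to itself is an arrow of G whose conjugation fixes f1, that is, which
    commutes with the image of f1. *)
Lemma arr2_comm a b : cmp (arr2 b) (hfun f1 a) = cmp (hfun f1 a) (arr2 b).
Proof.
have sa := (hiso f1 a).1; have ta := (hiso f1 a).2.
have := f_equal (fun x : ghom Gam1 G => hfun x a) (hiso f b).2.
rewrite /= conj_funE -/(arr2 b) hfun_snd => E.
by rewrite -[in RHS]E cmpKVg // src_cmp ?src_arr2 ?sa ?ta.
Qed.

Lemma arr2_1 : arr2 1%g = idn (base f1).
Proof. by rewrite /arr2 hfun1. Qed.

Lemma arr2_mul b b' : arr2 (b * b')%g = cmp (arr2 b) (arr2 b').
Proof. by rewrite /arr2 (hmul (hfun_composable f b b')) fst_comp. Qed.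

Definition merge_fun (c : Gam12) : arr G := cmp (hfun f1 c.1) (arr2 c.2).

Lemma merge_iso c : isotropy (base f1) (merge_fun c).
Proof.
have e : src (hfun f1 c.1) = tgt (arr2 c.2) by rewrite (hiso f1 _).1 tgt_arr2.
by split; rewrite ?src_cmp ?tgt_cmp ?src_arr2 // (hiso f1 _).2.
Qed.

Lemma merge_mul c d (e : src (merge_fun c) = tgt (merge_fun d)) :
  merge_fun (c * d)%g = comp (merge_fun c) (merge_fun d) e.
Proof.
rewrite cmpE; case: c e => a b; case: d => a' b' _.
rewrite /merge_fun /= hfunM arr2_mul.
have [sa ta] := hiso f1 a; have [sa' ta'] := hiso f1 a'.
have [sb tb] := (src_arr2 b, tgt_arr2 b).
have [sb' tb'] := (src_arr2 b', tgt_arr2 b').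
rewrite [RHS]cmpA ?src_cmp ?sa ?sb ?ta' ?tb ?tb' //.
rewrite -[X in _ = cmp X _]cmpA ?sa ?sb ?ta' ?tb //.
(* After reassociation the two inner factors, one from each group, are exchanged. *)
rewrite arr2_comm [X in _ = cmp X _]cmpA ?sa ?sa' ?tb ?ta' //.
by rewrite -[RHS]cmpA ?src_cmp ?sa ?sa' ?tb ?ta' ?sb ?tb'.
Qed.

Definition merge_hom : ghom Gam12 G := GHom merge_iso merge_mul.

Lemma base_merge : base merge_hom = base (base f).
Proof. by []. Qed.

Lemma hfun_merge c : hfun merge_hom c = cmp (hfun (base f) c.1) (arr2 c.2).
Proof. by []. Qed.

End Merge.

Section Split.
Variable f : ghom Gam12 G.

Definition restrict1_fun (a : Gam1) : arr G := hfun f (a, 1%g).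

Lemma restrict1_iso a : isotropy (base f) (restrict1_fun a).
Proof. exact: hiso. Qed.

Lemma restrict1_mul a b (e : src (restrict1_fun a) = tgt (restrict1_fun b)) :
  restrict1_fun (a * b)%g = comp (restrict1_fun a) (restrict1_fun b) e.
Proof. by rewrite cmpE -hfunM; congr hfun; congr pair; rewrite mulg1. Qed.

Definition restrict1 : ghom Gam1 G := GHom restrict1_iso restrict1_mul.

Definition split_fun (b : Gam2) : arr S1 :=
  exist (fun p : arr G * ghom Gam1 G => src p.1 = base p.2)
    (hfun f (1%g, b), restrict1) (hiso f (1%g, b)).1.

(** In the product group (1, b) commutes with every (a, 1), so conjugation by its image fixes the
    restriction of f to the first factor. *)
Lemma split_iso b : @isotropy S1 restrict1 (split_fun b).
Proof.
split=> //; apply: ghom_eq => [|a] /=; first exact: (hiso f _).2.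
rewrite conj_funE /= /restrict1_fun -hfunV -!hfunM; congr hfun; congr pair => /=.
  by rewrite mul1g invg1 mulg1.
by rewrite mulg1 mulgV.
Qed.

Lemma split_mul a b (e : src (split_fun a) = tgt (split_fun b)) :
  split_fun (a * b)%g = comp (split_fun a) (split_fun b) e.
Proof.
apply: tr_arr_eq => //=; rewrite cmpE -hfunM; congr hfun; congr pair.
by rewrite mulg1.
Qed.

Definition split_hom : ghom Gam2 S1 := GHom split_iso split_mul.

End Split.

Lemma restrict1_merge f : restrict1 (merge_hom f) = base f.
Proof.
apply: ghom_eq => // a; rewrite /= /restrict1_fun /= /merge_fun arr2_1 cmpg1 //.
exact: (hiso _ _).1.
Qed.

Lemma mergeK : cancel merge_hom split_hom.
Proof.
move=> f; apply: ghom_eq => [|b]; first exact: restrict1_merge.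
apply: tr_arr_eq => /=; last by rewrite restrict1_merge hfun_snd.
by rewrite /merge_fun hfun1 cmp1g // tgt_arr2.
Qed.

Lemma splitK : cancel split_hom merge_hom.
Proof.
move=> f; apply: ghom_eq => // -[a b]; rewrite /= /merge_fun /arr2 /=.
rewrite /restrict1_fun -hfunM; congr hfun; congr pair => /=; first exact: mulg1.
exact: mul1g.
Qed.

Lemma merge_arr_proof (t : arr S2S1) :
  src (sval (sval t).1).1 = base (merge_hom (sval t).2).
Proof.
exact: (etrans (proj2_sig (sval t).1) (f_equal (@base _ _) (proj2_sig t))).
Qed.

(** The acting arrow of G is kept; the intermediate homomorphism from [Gam1] is dropped, being the
    base of the one from [Gam2]. *)
Definition merge_arr (t : arr S2S1) : arr S12 :=
  exist (fun p : arr G * ghom Gam12 G => src p.1 = base p.2)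
    ((sval (sval t).1).1, merge_hom (sval t).2) (merge_arr_proof t).

Definition split_arr (t : arr S12) : arr S2S1 :=
  exist (fun p : arr S1 * ghom Gam2 S1 => src p.1 = base p.2)
    (exist (fun p : arr G * ghom Gam1 G => src p.1 = base p.2)
      ((sval t).1, restrict1 (sval t).2) (proj2_sig t), split_hom (sval t).2) erefl.

Lemma merge_arrK : cancel merge_arr split_arr.
Proof.
move=> t; apply: tr_arr_eq => /=; last exact: mergeK.
apply: tr_arr_eq => //=.
exact: (etrans (restrict1_merge _) (esym (proj2_sig t))).
Qed.

Lemma split_arrK : cancel split_arr merge_arr.
Proof. by move=> t; apply: tr_arr_eq => //=; exact: splitK. Qed.

Lemma arr2_tgt (t : arr S2S1) b :
  let h := (sval (sval t).1).1 in
  arr2 (tgt t) b = cmp (cmp h (arr2 (sval t).2 b)) (inv h).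
Proof. by rewrite /arr2 hfun_tgt /conj_fun !fst_comp. Qed.

(** Conjugation by h is multiplicative, so conjugating the product of the two values agrees with
    multiplying their conjugates. *)
Lemma merge_arr_tgt t : tgt (merge_arr t) = merge_hom (tgt t).
Proof.
have xf : (sval (sval t).1).2 = base (sval t).2 := proj2_sig t.
apply: (@ghom_eq Gam12 G).
  by rewrite base_tgt base_merge (base_tgt (G := S1)) base_tgt.
move=> [a b]; rewrite hfun_tgt conj_funE.
set h := (sval (sval t).1).1; set f := (sval t).2.
rewrite -[sval (merge_arr t)]/(h, merge_hom f) 2!hfun_merge.
rewrite arr2_tgt (base_tgt (G := S1)) hfun_tgt conj_funE xf.
rewrite -/h -/f -[(_, merge_hom f).1]/h -[(a, b).1]/a -[(a, b).2]/b.
have [sa ta] := hiso (base f) a; have [sb tb] := (src_arr2 f b, tgt_arr2 f b).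
have sh : src h = base (base f) by rewrite -xf; exact: (proj2_sig (sval t).1).
have eX : src (cmp (cmp h (hfun (base f) a)) (inv h)) = tgt h.
  by rewrite src_cmp ?src_inv // tgt_inv src_cmp ?sh ?sa ?ta.
rewrite [RHS]cmpA; last 2 first.
- by rewrite eX !tgt_cmp ?src_cmp ?tgt_inv ?sh ?sb ?tb.
- by rewrite src_cmp ?tgt_inv ?sh ?sb ?tb.
(* The inner factors [inv h] and h cancel. *)
rewrite [X in _ = cmp X _]cmpA ?sh ?tb // cmpKVg; last first.
  by rewrite src_cmp ?sh ?sa ?ta.
by rewrite cmpA ?sh ?sa ?ta ?tb.
Qed.

Lemma merge_arr_idn x : merge_arr (idn x) = idn (merge_hom x : ob S12).
Proof. exact: tr_arr_eq. Qed.

Lemma merge_arr_comp (g h : arr S2S1) (e : src g = tgt h)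
    (e' : src (merge_arr g) = tgt (merge_arr h)) :
  merge_arr (comp g h e) = comp (merge_arr g) (merge_arr h) e'.
Proof. by apply: tr_arr_eq => //=; exact: comp_congr. Qed.

Definition merge_functor : gfunctor S2S1 S12 :=
  @GFunctor S2S1 S12 merge_hom merge_arr (fun=> erefl) merge_arr_tgt merge_arr_idn
    merge_arr_comp.

End Iterated.

(** Left transparent so that [fob] and [farr] of the composite compute. *)
Definition gfunctor_comp (G H K : groupoid) (F2 : gfunctor H K)
    (F1 : gfunctor G H) : gfunctor G K.
Proof.
refine (@GFunctor G K (fob F2 \o fob F1) (farr F2 \o farr F1) _ _ _ _).
- by move=> g /=; rewrite !fsrc.
- by move=> g /=; rewrite !ftgt.
- by move=> x /=; rewrite !fidn.
- move=> g h e e' /=.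
  have e1 : src (farr F1 g) = tgt (farr F1 h) by rewrite fsrc e -ftgt.
  by rewrite (fcomp e e1) (fcomp e1 e').
Defined.

(** * Morita equivalence *)

Section EquivalenceComp.
Variables (R : realType) (H G G' : gpd_with_atlases R).
Variables (F : gfunctor H G) (K : gfunctor G G').
Variables (Ko' : ob G' -> ob G) (Ka' : arr G' -> arr G).

Hypotheses (KoK : cancel (fob K) Ko') (Ko'K : cancel Ko' (fob K)).
Hypotheses (KaK : cancel (farr K) Ka') (Ka'K : cancel Ka' (farr K)).
Hypotheses (lieH : lie_groupoid H) (lieG : lie_groupoid G)
  (lieG' : lie_groupoid G').
Hypotheses (pKo : @plot_preserving R (obm G) (obm G') (fob K))
  (pKo' : @plot_preserving R (obm G') (obm G) Ko')
  (pKa : @plot_preserving R (arrm G) (arrm G') (farr K))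
  (pKa' : @plot_preserving R (arrm G') (arrm G) Ka').

Local Notation P := (@fibprod R (arrm G) (obm H) _ (@src G) (fob F)).
Local Notation P' := (@fibprod R (arrm G') (obm H) _ (@src G') (fob K \o fob F)).

Lemma src_farr_inv g : src (Ka' g) = Ko' (src g).
Proof. by rewrite -[in RHS](Ka'K g) fsrc KoK. Qed.

Lemma tgt_farr_inv g : tgt (Ka' g) = Ko' (tgt g).
Proof. by rewrite -[in RHS](Ka'K g) ftgt KoK. Qed.

Lemma fib_push_proof (t : carrier P) : src (farr K (sval t).1) = fob K (fob F (sval t).2).
Proof. by rewrite fsrc (proj2_sig t). Qed.

Definition fib_push (t : carrier P) : carrier P' :=
  exist (fun p : arr G' * ob H => src p.1 = fob K (fob F p.2))
    (farr K (sval t).1, (sval t).2) (fib_push_proof t).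

Lemma fib_pull_proof (t : carrier P') : src (Ka' (sval t).1) = fob F (sval t).2.
Proof. by rewrite src_farr_inv (proj2_sig t) /= KoK. Qed.

Definition fib_pull (t : carrier P') : carrier P :=
  exist (fun p : arr G * ob H => src p.1 = fob F p.2)
    (Ka' (sval t).1, (sval t).2) (fib_pull_proof t).

Lemma sval_inj (T : Type) (A : T -> Prop) (x y : {t | A t}) :
  sval x = sval y -> x = y.
Proof.
by case: x y => x Ax [y Ay] /= xy; subst y; congr exist; exact: Prop_irrelevance.
Qed.

Lemma fib_pushK : cancel fib_push fib_pull.
Proof. by move=> t; apply: sval_inj; rewrite /= KaK -surjective_pairing. Qed.

Lemma fib_pullK : cancel fib_pull fib_push.
Proof. by move=> t; apply: sval_inj; rewrite /= Ka'K -surjective_pairing. Qed.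

Lemma smooth_rep_pull (q : param R (carrier P)) (p : param R (carrier P')) :
  smooth_rep id (comp_param fib_push q) p -> smooth_rep id q (comp_param fib_pull p).
Proof.
have dE : rep_dom id q (comp_param fib_pull p) = rep_dom id (comp_param fib_push q) p.
  apply/seteqP; split=> u [qu [v pv vE]]; split=> //; exists v => //=.
    by rewrite -[LHS]fib_pullK; congr fib_push.
  by rewrite vE /= fib_pushK.
move=> [op [g [sg gP]]]; rewrite /smooth_rep /is_rep dE; split=> //.
exists g; split=> // u /gP[pg gE]; split=> //=.
by rewrite gE /= fib_pushK.
Qed.

(** Both [farr K] and its inverse preserve plots, so componentwise plots of the two fibre products
    correspond, and with them the universal property defining [plot_atlas]. *)
Lemma atlas_fib_pull (p : param R (carrier P')) :
  atlas P' p -> atlas P (comp_param fib_pull p).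
Proof.
move=> [[pA pO] pI pS]; split.
- by split; [exact: (pKa' pA)|exact: pO].
- move=> u v pu pv uv; apply: pI => //.
  by rewrite -[LHS]fib_pullK -[RHS]fib_pullK; congr fib_push.
- move=> q [qA qO]; apply/smooth_rep_pull/pS; split; last exact: qO.
  exact: (pKa qA).
Qed.

(** K and its inverse preserve plots on objects and on arrows, so each clause for F is carried along
    K. *)
Lemma lie_equivalence_comp :
  lie_equivalence F -> lie_equivalence (gfunctor_comp K F).
Proof.
have [[mHo mHa] _ _ _ _] := lieH; have [[mGo mGa] _ _ _ _] := lieG.
have [[mGo' mGa'] [_ [stgt' _]] _ _ _] := lieG'.
move=> [[sFo sFa] [subF surF] ffF plotF]; split.
- split; apply: plot_smooth => p Hp.
    apply: (pKo (p := comp_param (fob F) p)).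
    exact: (smooth_plot sFo Hp ((manifold_covered mHo).1 p Hp)).
  apply: (pKa (p := comp_param (farr F) p)).
  exact: (smooth_plot sFa Hp ((manifold_covered mHa).1 p Hp)).
- split; last first.
    move=> x; have [p pE] := surF (Ko' x).
    by exists (fib_push p); rewrite /= ftgt pE Ko'K.
  (* The fibre products are matched by [fib_pull] and the object manifolds by [fob K]. *)
  apply: (submersion_transfer mGo mGo' pKo pKo' KoK Ko'K atlas_fib_pull _ subF).
    by move=> t /=; rewrite -ftgt Ka'K.
  apply: plot_smooth => p [[pA _] _ _].
  exact: (smooth_plot_preserving mGa' mGo' stgt' pA).
- move=> y y' g gy gy'.
  have gs : src (Ka' g) = fob F y by rewrite src_farr_inv gy /= KoK.
  have gt : tgt (Ka' g) = fob F y' by rewrite tgt_farr_inv gy' /= KoK.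
  have [h [[hy hy' hE] hU]] := ffF y y' (Ka' g) gs gt.
  exists h; split; first by split; rewrite //= hE Ka'K.
  move=> k [ky ky' kE]; apply: hU; split=> //.
  by rewrite -kE /= KaK.
- move=> p op ps pt pF; apply: plotF => //.
  have := pKa' pF; congr (plot _ _); congr Param.
  by apply/funext => u /=; rewrite KaK.
Qed.

End EquivalenceComp.

(** * Smoothness of the isomorphism and of its inverse *)

Section IteratedPlots.
Variables (R : realType) (Gam1 Gam2 : groupType) (G : gpd_with_atlases R).

Local Notation Gam12 := (Gam1 * Gam2)%type.
Local Notation S1 := (sector_lie_groupoid Gam1 G).
Local Notation S12 := (sector_lie_groupoid Gam12 G).
Local Notation S2S1 := (sector_lie_groupoid Gam2 S1).

Variables (s1 : seq Gam1) (s2 : seq Gam2).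
Hypotheses (gen1 : generates s1) (gen2 : generates s2).
Hypotheses (lieG : lie_groupoid G) (lieS1 : lie_groupoid S1)
  (lieS12 : lie_groupoid S12) (lieS2S1 : lie_groupoid S2S1).

(** Each factor is generated by its own list, and (a, b) is the product of (a, 1) and (1, b). *)
Lemma generates_prod :
  generates ([seq (a, 1%g) | a <- s1] ++ [seq (1%g, b) | b <- s2] : seq Gam12).
Proof.
move=> A A1 AM AV As.
have left_ a : A (a, 1%g).
  elim/gen1: a => [//|a b Aa Ab|a Aa|a a1]; last first.
  - by apply: As; rewrite mem_cat map_f.
  - by have := AV _ Aa; congr A; congr pair; rewrite /= invg1.
  - by have := AM _ _ Aa Ab; congr A; congr pair; rewrite /= mulg1.
have right_ b : A (1%g, b).
  elim/gen2: b => [//|a b Aa Ab|a Aa|a a1]; last first.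
  - by apply: As; rewrite mem_cat map_f ?orbT.
  - by have := AV _ Aa; congr A; congr pair; rewrite /= invg1.
  - by have := AM _ _ Aa Ab; congr A; congr pair; rewrite /= mulg1.
move=> [a b]; have := AM _ _ (left_ a) (right_ b).
by congr A; congr pair; rewrite /= ?mulg1 ?mul1g.
Qed.

Let mGo : is_manifold (obm G). Proof. by have [[]] := lieG. Qed.
Let mGa : is_manifold (arrm G). Proof. by have [[]] := lieG. Qed.
Let mS1o : is_manifold (obm S1). Proof. by have [[]] := lieS1. Qed.
Let mS1a : is_manifold (arrm S1). Proof. by have [[]] := lieS1. Qed.

Lemma restrict1_plot_preserving :
  @plot_preserving R (obm S12) (obm S1) (@restrict1 Gam1 Gam2 G).
Proof.
move=> p plp; apply: (plot_sector gen1).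
- exact: manifold_covered.
- exact: manifold_covered.
- exact: (base_plot_preserving lieG lieS12 plp).
- by move=> a _; exact: (hfun_plot_preserving lieG lieS12 (a, 1%g) plp).
Qed.

Lemma split_plot_preserving :
  @plot_preserving R (obm S12) (obm S2S1) (@split_hom Gam1 Gam2 G).
Proof.
move=> p plp; apply: (plot_sector gen2).
- exact: manifold_covered.
- exact: manifold_covered.
- exact: (restrict1_plot_preserving plp).
- move=> b _; apply: plot_sector_arr; last exact: (restrict1_plot_preserving plp).
  exact: (hfun_plot_preserving lieG lieS12 (1%g, b) plp).
Qed.

Lemma merge_plot_preserving :
  @plot_preserving R (obm S2S1) (obm S12) (@merge_hom Gam1 Gam2 G).
Proof.
move=> p plp; have plb := base_plot_preserving lieS1 lieS2S1 plp.
apply: (plot_sector generates_prod).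
- exact: manifold_covered.
- exact: manifold_covered.
- exact: (base_plot_preserving lieG lieS1 plb).
(* On the two kinds of generators the merged homomorphism takes a value of [base f] or an arrow
   [arr2 f b], and both vary smoothly with f. *)
move=> c; rewrite mem_cat => /orP[] /mapP[a _ ->].
- have := hfun_plot_preserving lieG lieS1 a plb.
  congr (plot _ _); congr Param; apply/funext => u /=.
  by rewrite /merge_fun arr2_1 cmpg1 //; exact: (hiso _ _).1.
- have := sector_arr_fst_plot_preserving lieG lieS1
    (hfun_plot_preserving lieS1 lieS2S1 a plp).
  congr (plot _ _); congr Param; apply/funext => u /=.
  by rewrite /merge_fun hfun1 cmp1g // tgt_arr2.
Qed.

Lemma merge_arr_plot_preserving :
  @plot_preserving R (arrm S2S1) (arrm S12) (@merge_arr Gam1 Gam2 G).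
Proof.
move=> p plp; apply: plot_sector_arr.
  exact: (sector_arr_fst_plot_preserving lieG lieS1
    (sector_arr_fst_plot_preserving lieS1 lieS2S1 plp)).
exact: (merge_plot_preserving (sector_arr_snd_plot_preserving lieS2S1 plp)).
Qed.

Lemma split_arr_plot_preserving :
  @plot_preserving R (arrm S12) (arrm S2S1) (@split_arr Gam1 Gam2 G).
Proof.
move=> p plp; have pls := sector_arr_snd_plot_preserving lieS12 plp.
apply: plot_sector_arr; last exact: (split_plot_preserving pls).
apply: plot_sector_arr; last exact: (restrict1_plot_preserving pls).
exact: (sector_arr_fst_plot_preserving lieG lieS12 plp).
Qed.

Lemma lie_equivalence_merge (H : gpd_with_atlases R) (F : gfunctor H S2S1) :
  lie_groupoid H -> lie_equivalence F ->
  lie_equivalence (gfunctor_comp (merge_functor Gam1 Gam2 G) F : gfunctor H S12).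
Proof.
move=> lieH.
apply: (@lie_equivalence_comp R H S2S1 S12 F (merge_functor Gam1 Gam2 G)
  (@split_hom Gam1 Gam2 G) (@split_arr Gam1 Gam2 G)) => //.
- exact: mergeK.
- exact: splitK.
- exact: merge_arrK.
- exact: split_arrK.
- exact: merge_plot_preserving.
- exact: split_plot_preserving.
- exact: merge_arr_plot_preserving.
- exact: split_arr_plot_preserving.
Qed.

End IteratedPlots.

Theorem theorem3p1 (Gam1 Gam2 : groupType)
  (fg1 : finitely_generated Gam1) (fg2 : finitely_generated Gam2) :
  (forall G : groupoid,
     groupoid_isomorphic
       (sector_groupoid Gam2 (sector_groupoid Gam1 G))
       (sector_groupoid (Gam1 * Gam2)%type G)) /\
  (forall (R : realType) (G : gpd_with_atlases R) (Q Q1 Q12 Q' : orbifold R),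
     orbifold_groupoid G ->
     presents Q G ->
     presents Q1 (sector_lie_groupoid Gam1 G) ->
     presents Q12 (sector_lie_groupoid Gam2 (sector_lie_groupoid Gam1 G)) ->
     presents Q' (sector_lie_groupoid (Gam1 * Gam2)%type G) ->
     orbifold_diffeomorphic Q12 Q').
Proof.
split=> [G|R G Q Q1 Q12 Q' [lieG _ _] _ pS1 pS2S1 pS12].
  exists (merge_functor Gam1 Gam2 G); split.
    by exists (@split_hom Gam1 Gam2 G); [exact: mergeK|exact: splitK].
  by exists (@split_arr Gam1 Gam2 G); [exact: merge_arrK|exact: split_arrK].
(* Applied to a presenting groupoid and itself, [presents_morita] shows that it is an orbifold
   groupoid, in particular a Lie groupoid. *)
have [[lieS1 _ _] _] := (presents_morita pS1 _).1 pS1.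
have [[lieS12 _ _] _] := (presents_morita pS12 _).1 pS12.
(* Of the span from the iterated groupoid to itself the leg F is kept; it serves as one leg as it
   stands and as the other after composition with the isomorphism. *)
have [[lieS2S1 _ _] [H [lieH [[F eF] _]]]] := (presents_morita pS2S1 _).1 pS2S1.
have [s1 gen1] := fg1; have [s2 gen2] := fg2.
exists (sector_lie_groupoid Gam2 (sector_lie_groupoid Gam1 G)).
exists (sector_lie_groupoid (Gam1 * Gam2)%type G); split=> //.
exists H; split=> //; split; first by exists F.
exists (gfunctor_comp (merge_functor Gam1 Gam2 G) F).
exact: (lie_equivalence_merge gen1 gen2).
Qed.
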